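(* Let $M$ be an oriented $n$-dimensional Riemannian manifold with a $Spin^r(n)$ structure ($r\ge 2$), with auxiliary rank $r$ oriented Riemannian bundle $F$ endowed with a metric connection $\nabla^F$, and let $m\in\mathbb N$ be such that $S=S(TM)\otimes S(F)^{\otimes m}$ is globally defined. Let $(e_1,\dots,e_n)$ and $(f_1,\dots,f_r)$ be local orthonormal frames of $TM$ and $F$. Then for every $X\in\Gamma(TM)$ and $\phi\in\Gamma(S)$, $$\sum_{i=1}^n e_i\cdot R^{\theta}(X,e_i)(\phi)=-\frac12\,\mathrm{Ric}(X)\cdot\phi+\frac12\sum_{k<l}(X\lrcorner\Theta_{kl})\cdot\kappa^m_{r*}(f_kf_l)\cdot\phi .$$
   Context: Clifford algebra: $Cl_n$ is generated by an orthonormal basis $e_1,\dots,e_n$ of $\mathbb R^n$ with $e_ie_j+e_je_i=-2\delta_{ij}$; $\Delta_n=\mathbb C^{2^{[n/2]}}$ is the complex spinor space, on which $Cl_n$ acts via $\kappa$ (the isomorphism $Cl_n\otimes\mathbb C\cong\mathrm{End}(\Delta_n)$ for $n$ even; for $n$ odd the isomorphism with $\mathrm{End}(\Delta_n)\oplus\mathrm{End}(\Delta_n)$ followed by the projection to the first summand). Clifford multiplication is $x\cdot\phi=\kappa(x)\phi$. 1-forms are identified with vectors by the metric. $Spin(n)\subset Cl_n$ has Lie algebra spanned by $e_ie_j$, $i<j$; $\lambda_n:Spin(n)\to SO(n)$ is the double cover, with $\lambda_{n*}(e_ie_j)=2E_{ij}$, $E_{ij}:e_i\mapsto e_j,\ e_j\mapsto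 -e_i$. $\kappa^m_r$ is the representation of $Spin(r)$ on $\Delta_r^{\otimes m}$, and $\kappa^m_{r*}(f_kf_l)$ is the sum over $a=1,\dots,m$ of Clifford multiplication by $f_kf_l$ in the $a$-th factor. On $\Delta_n\otimes\Delta_r^{\otimes m}$, vectors of $\mathbb R^n$ act on $\Delta_n$ and $\kappa^m_{r*}(f_kf_l)$ acts on $\Delta_r^{\otimes m}$. $Spin^r(n)=(Spin(n)\times Spin(r))/\{\pm(1,1)\}$. A $Spin^r(n)$ structure on $M$ is a principal $SO(r)$-bundle $P_{SO(r)}$ and a principal $Spin^r(n)$-bundle $P$ with a 2:1 covering $P\to P_{SO(M)}\tilde\times P_{SO(r)}$ (fibered product) equivariant with respect to $\lambda_n\times\lambda_r$. $F$ is the rank $r$ vector bundle associated to $P_{SO(r)}$, and $S=S(TM)\otimes S(F)^{\otimes m}$ is the bundle with fiber $\Delta_n\otimes\Delta_r^{\otimes m}$ associated to the representation $\kappa_n\otimes\kappa_r^m$; it is globally defined if $m$ is odd (structure group $Spin^r(n)$), or if $M$ and $F$ are both Spin (group $Spin(n)\times Spin(r)$, any $m$), or if $M$ is Spin and $m$ is even (group $Spin(n)\times SO(r)$). $\nabla^\theta$ is the covariant derivative on $S$ induced by the Levi-Civita connection and $\nabla^F$, and $R^\theta(X,Y)=[\nabla^\theta_X,\nabla^\theta_Y]-\nabla^\theta_{[X,Y]}$; on $\psi\otimes\varphi$, $R^\theta(X,Y)(\psi\otimes\varphi)=\frac12\sum_{i<j}\langle R^M(X,Y)e_i,e_j\rangle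 e_ie_j\cdot\psi\otimes\varphi+\psi\otimes\frac12\sum_{k<l}\Theta_{kl}(X,Y)\kappa^m_{r*}(f_kf_l)\cdot\varphi$, where $\Theta_{kl}(X,Y)=\langle R^F(X,Y)f_k,f_l\rangle$. $\mathrm{Ric}$ is the Ricci endomorphism of $M$ (positive on round spheres) and $\lrcorner$ is contraction. *)

(* Defs.v *)
From HB Require Import structures.
From mathcomp Require Import all_boot all_order all_algebra.
From mathcomp Require Import all_classical all_reals all_analysis.
From mathcomp Require Import complex.

Set Implicit Arguments.
Unset Strict Implicit.
Unset Printing Implicit Defensive.

Import Order.TTheory GRing.Theory Num.Theory numFieldNormedType.Exports.
Local Open Scope classical_set_scope.
Local Open Scope ring_scope.

Section Calculus.
Variables (R : realType) (n : nat).

Definition partial (i : 'I_n) (f : 'rV[R]_n -> R) : 'rV[R]_n -> R :=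
  fun x => 'D_(delta_mx 0 i) f x.

Fixpoint Ck (k : nat) (V : set 'rV[R]_n) (f : 'rV[R]_n -> R) : Prop :=
  if k is k'.+1 then
    (forall x, V x -> differentiable f x) /\ (forall i, Ck k' V (partial i f))
  else forall x, V x -> {for x, continuous f}.

Definition Cinfty (V : set 'rV[R]_n) (f : 'rV[R]_n -> R) : Prop :=
  forall k, Ck k V f.

End Calculus.

(* [chart_inv i] is only meaningful on the image of [chart_dom i]. *)
Record atlas (R : realType) (n : nat) (M : topologicalType) := Atlas {
  chart_index : Type;
  chart_dom : chart_index -> set M;
  chart : chart_index -> M -> 'rV[R]_n;
  chart_inv : chart_index -> 'rV[R]_n -> M }.

Section Manifold.
Variables (R : realType) (n : nat) (M : topologicalType) (A : atlas R n M).

Record smooth_manifold : Prop := {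
  mfd_hausdorff : hausdorff_space M;
  mfd_countable : @second_countable M;
  mfd_open : forall i, open (chart_dom (a := A) i);
  mfd_cover : forall p : M, exists i, chart_dom (a := A) i p;
  mfd_img_open : forall i, open (chart i @` chart_dom (a := A) i);
  mfd_chartK : forall i p, chart_dom (a := A) i p -> chart_inv i (chart i p) = p;
  mfd_chart_cont : forall i p, chart_dom (a := A) i p ->
    {for p, continuous (chart (a := A) i)};
  mfd_inv_cont : forall i p, chart_dom (a := A) i p ->
    {for chart i p, continuous (chart_inv (a := A) i)};
  mfd_transition : forall (i j : chart_index A) (k : 'I_n),
    Cinfty (chart i @` (chart_dom i `&` chart_dom j))
           (fun x => chart j (chart_inv i x) 0 k) }.

Definition smooth_on (W : set M) (f : M -> R) : Prop :=
  forall i : chart_index A,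
    Cinfty (chart i @` (chart_dom i `&` W)) (fun x => f (chart_inv i x)).

Definition smooth_at (p : M) (f : M -> R) : Prop :=
  exists W : set M, [/\ open W, W p & smooth_on W f].

(* A tangent vector is a derivation of the algebra of functions smooth near
   [p]; it depends on the germ only, as the indicator of a neighbourhood of [p]
   is idempotent and smooth near [p].  The value 0 on functions not smooth
   near [p] makes the representation unique. *)
Definition tvec := (M -> R) -> R^o.

Record tangent (p : M) (D : tvec) : Prop := {
  tan_add : forall f h, smooth_at p f -> smooth_at p h ->
    D (fun q => f q + h q) = D f + D h;
  tan_scale : forall (c : R) f, smooth_at p f -> D (fun q => c * f q) = c * D f;
  tan_mul : forall f h, smooth_at p f -> smooth_at p h ->
    D (fun q => f q * h q) = f p * D h + h p * D f;
  tan_default : forall f, ~ smooth_at p f -> D f = 0 }.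

Definition vector_field (W : set M) (X : M -> tvec) : Prop :=
  (forall p, W p -> tangent p (X p)) /\
  (forall (V : set M) f, open V -> V `<=` W -> smooth_on V f ->
     smooth_on V (fun p => X p f)).

Definition lie (X Y : M -> tvec) : M -> tvec := fun p f =>
  if `[< smooth_at p f >]
  then X p (fun q => Y q f) - Y p (fun q => X q f) else 0.

(* Fibers are subsets of a common carrier; [vb_section W s] says that [s] is a
   smooth section over [W], values outside [W] being irrelevant. *)
Record vbundle := VBundle {
  vb_carrier : lmodType R;
  vb_fiber : M -> set vb_carrier;
  vb_inner : M -> vb_carrier -> vb_carrier -> R;
  vb_section : set M -> (M -> vb_carrier) -> Prop }.

Record inner_product (E : lmodType R) (S : set E) (b : E -> E -> R) : Prop := {
  ip_sym : forall v w, S v -> S w -> b v w = b w v;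
  ip_add : forall u v w, S u -> S v -> S w -> b (u + v) w = b u w + b v w;
  ip_scale : forall (c : R) v w, S v -> S w -> b (c *: v) w = c * b v w;
  ip_pos : forall v, S v -> v != 0 -> 0 < b v v }.

Record orthonormal_frame (E : vbundle) (k : nat) (W : set M)
    (e : 'I_k -> M -> vb_carrier E) : Prop := {
  onf_section : forall i, vb_section W (e i);
  onf_orthonormal : forall p, W p -> forall i j,
    vb_inner p (e i p) (e j p) = (i == j)%:R;
  onf_span : forall p, W p -> forall v, vb_fiber p v ->
    exists c : 'I_k -> R, v = \sum_i c i *: e i p }.

Record riemannian_bundle (k : nat) (E : vbundle) : Prop := {
  rb_zero : forall p, vb_fiber (v := E) p 0;
  rb_linear : forall p (c : R) v w, vb_fiber (v := E) p v ->
    vb_fiber (v := E) p w -> vb_fiber (v := E) p (c *: v + w);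
  rb_inner : forall p, inner_product (vb_fiber (v := E) p) (vb_inner (v := E) p);
  rb_restrict : forall (V W : set M) s, open V -> open W -> V `<=` W ->
    vb_section (v := E) W s -> vb_section (v := E) V s;
  rb_glue : forall (W : set M) s, open W ->
    (forall p, W p -> exists V : set M,
       [/\ open V, V p & vb_section (v := E) V s]) -> vb_section (v := E) W s;
  rb_trivial : forall p, exists (W : set M) (e : 'I_k -> M -> vb_carrier E),
    [/\ open W, W p, orthonormal_frame W e &
      forall (V : set M) s, open V -> V `<=` W ->
        vb_section (v := E) V s <->
        (forall q, V q -> vb_fiber (v := E) q (s q)) /\
        (forall i, smooth_on V (fun q => vb_inner q (s q) (e i q)))] }.

Definition is_basis (E : lmodType R) (S : set E) (k : nat) (b : 'I_k -> E) :=
  (forall i, S (b i)) /\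
  (forall v, S v -> exists! c : 'cV[R]_k, v = \sum_i c i 0 *: b i).

(* An orientation is the predicate selecting the positive bases. *)
Record orientation (k : nat) (E : vbundle)
    (pos : M -> ('I_k -> vb_carrier E) -> Prop) : Prop := {
  or_class : forall p (b b' : 'I_k -> vb_carrier E) (T : 'M[R]_k),
    is_basis (vb_fiber (v := E) p) b -> is_basis (vb_fiber (v := E) p) b' ->
    (forall j, b' j = \sum_i T i j *: b i) ->
    pos p b -> (pos p b' <-> 0 < \det T);
  or_local : forall p, exists (W : set M) (e : 'I_k -> M -> vb_carrier E),
    [/\ open W, W p, orthonormal_frame W e &
      forall q, W q -> pos q (fun i => e i q)] }.

Definition connection_op (E : Type) := M -> tvec -> (M -> E) -> E.

Definition section_at (E : vbundle) (p : M) (s : M -> vb_carrier E) : Prop :=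
  exists W : set M, [/\ open W, W p & vb_section W s].

Record metric_connection (E : vbundle)
    (nabla : connection_op (vb_carrier E)) : Prop := {
  conn_fiber : forall p v s, tangent p v -> section_at p s ->
    vb_fiber p (nabla p v s);
  conn_linearl : forall p (c : R) v w s,
    tangent p v -> tangent p w -> section_at p s ->
    nabla p (c *: v + w) s = c *: nabla p v s + nabla p w s;
  conn_addr : forall p v s t, tangent p v -> section_at p s -> section_at p t ->
    nabla p v (fun q => s q + t q) = nabla p v s + nabla p v t;
  conn_leibniz : forall p v f s, tangent p v -> smooth_at p f ->
    section_at p s ->
    nabla p v (fun q => f q *: s q) = (v f : R) *: s p + f p *: nabla p v s;
  conn_smooth : forall (W : set M) X s, open W -> vector_field W X ->
    vb_section W s -> vb_section W (fun p => nabla p (X p) s);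
  conn_metric : forall p v s t, tangent p v -> section_at p s ->
    section_at p t ->
    v (fun q => vb_inner q (s q) (t q)) =
    vb_inner p (nabla p v s) (t p) + vb_inner p (s p) (nabla p v t) }.

Definition curvature (E : zmodType) (nabla : connection_op E)
    (X Y : M -> tvec) (s : M -> E) : M -> E := fun p =>
  nabla p (X p) (fun q => nabla q (Y q) s)
  - nabla p (Y p) (fun q => nabla q (X q) s)
  - nabla p (lie X Y p) s.

Record riemannian_metric (g : M -> tvec -> tvec -> R) : Prop := {
  rm_inner : forall p, inner_product (E := tvec) (tangent p) (g p);
  rm_smooth : forall (W : set M) X Y, open W ->
    vector_field W X -> vector_field W Y ->
    smooth_on W (fun p => g p (X p) (Y p)) }.

Definition tangent_bundle (g : M -> tvec -> tvec -> R) : vbundle :=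
  @VBundle tvec tangent g vector_field.

Record levi_civita (g : M -> tvec -> tvec -> R) (nabla : connection_op tvec)
    : Prop := {
  lc_metric : @metric_connection (tangent_bundle g) nabla;
  lc_torsion : forall (W : set M) X Y, open W ->
    vector_field W X -> vector_field W Y -> forall p, W p ->
    nabla p (X p) Y - nabla p (Y p) X = lie X Y p }.

(* Ricci endomorphism and metric dual of a 1-form, written in a local
   orthonormal frame [e], of which both are independent; with the present sign
   of the curvature, Ric is positive on round spheres. *)
Definition ricci (nabla : connection_op tvec) (e : 'I_n -> M -> tvec)
    (X : M -> tvec) : M -> tvec := fun p =>
  \sum_i curvature nabla X (e i) (e i) p.

Definition sharp (e : 'I_n -> M -> tvec) (alpha : (M -> tvec) -> M -> R)
    : M -> tvec := fun p =>
  \sum_i alpha (e i) p *: e i p.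

Definition theta_form (F : vbundle) (nablaF : connection_op (vb_carrier F))
    (r : nat) (f : 'I_r -> M -> vb_carrier F) (k l : 'I_r)
    (X Y : M -> tvec) : M -> R := fun p =>
  vb_inner p (curvature nablaF X Y (f k) p) (f l p).

Definition interior_form (X : M -> tvec)
    (omega : (M -> tvec) -> (M -> tvec) -> M -> R)
    : (M -> tvec) -> M -> R := omega X.

End Manifold.

Arguments vb_inner {R M} v _ _ _.
Arguments vb_section {R M} v _ _.
Arguments vb_fiber {R M} v _ _.

Section Clifford.
Variable R : realType.

(* [u B] is the coefficient of the ordered product of the e_i, i \in B. *)
Definition Cl (n : nat) := {ffun {set 'I_n} -> R^o}.

Definition cl1 {n} : Cl n := [ffun B => (B == finset.set0)%:R].

Definition cl_vec {n} (x : 'cV[R]_n) : Cl n :=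
  [ffun B => \sum_i x i 0 * (B == [set i]%SET)%:R].

(* e_A e_B = (-1)^#{(a, b) in A x B | b <= a} e_(A symmetric difference B):
   one sign for each transposition needed to sort, and one for each e_i^2. *)
Definition cl_mul {n} (u v : Cl n) : Cl n :=
  [ffun D : {set 'I_n} => \sum_(A : {set 'I_n})
     \sum_(B : {set 'I_n} | (A :\: B) :|: (B :\: A) == D)
       (-1) ^+ #|[set ab in finset.setX A B | (ab.2 <= ab.1)%N]%SET| * (u A * v B)].

Definition Spin {n} (u : Cl n) : Prop :=
  exists xs : seq 'cV[R]_n,
    [/\ ~~ odd (size xs),
        forall x, x \in xs -> \sum_i x i 0 ^+ 2 = 1 &
        u = foldr cl_mul cl1 [seq cl_vec x | x <- xs]].

(* [covers u T] : T = lambda_n u, i.e. u x u^-1 = T x for every vector x. *)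
Definition covers {n} (u : Cl n) (T : 'M[R]_n) : Prop :=
  forall x : 'cV[R]_n, cl_mul u (cl_vec x) = cl_mul (cl_vec (T *m x)) u.

(* kappa_n restricted to the generators e_i.  By dimension, such a family is
   the isomorphism of Cl_n (x) C with End(Delta_n) for n even, and one of its
   isomorphisms with End (+) End followed by the first projection for n odd. *)
Definition clifford_rep {n}
    (gamma : 'I_n -> 'M[R[i]]_(2 ^ n./2)) : Prop :=
  forall i j, gamma i *m gamma j + gamma j *m gamma i
              = (- 2 * (i == j)%:R)%:M.

Definition kappa {n} (gamma : 'I_n -> 'M[R[i]]_(2 ^ n./2)) (u : Cl n)
    : 'M[R[i]]_(2 ^ n./2) :=
  \sum_(B : {set 'I_n})
    ((u B : R)%:C)%C *: \big[mulmx/1%:M]_(i <- enum B) gamma i.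

Definition kappa_vec {n} (gamma : 'I_n -> 'M[R[i]]_(2 ^ n./2))
    (x : 'I_n -> R) : 'M[R[i]]_(2 ^ n./2) :=
  \sum_i ((x i)%:C)%C *: gamma i.

(* Delta_n (x) Delta_r^(x m), through the coordinates in the product basis. *)
Definition Delta_basis (n r m : nat) : finType :=
  ('I_(2 ^ n./2) * {ffun 'I_m -> 'I_(2 ^ r./2)})%type.

Definition Delta (n r m : nat) := {ffun Delta_basis n r m -> R[i]}.

Definition act_left {n r m} (T : 'M[R[i]]_(2 ^ n./2)) (psi : Delta n r m)
    : Delta n r m :=
  [ffun x : Delta_basis n r m => \sum_j T x.1 j * psi (j, x.2)].

Definition act_factor {n r m} (b : 'I_m) (T : 'M[R[i]]_(2 ^ r./2))
    (psi : Delta n r m) : Delta n r m :=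
  [ffun x : Delta_basis n r m => \sum_j T (x.2 b) j *
     psi (x.1, [ffun c => if c == b then j else x.2 c])].

(* derived action of an element of Lie(Spin(r)), acting on Delta_r by T *)
Definition act_lie {n r m} (T : 'M[R[i]]_(2 ^ r./2)) (psi : Delta n r m)
    : Delta n r m :=
  \sum_(b < m) act_factor b T psi.

(* (kappa_n (x) kappa_r^m)(u, v) *)
Definition act_spin {n r m} (gamma : 'I_n -> 'M[R[i]]_(2 ^ n./2))
    (delta : 'I_r -> 'M[R[i]]_(2 ^ r./2)) (u : Cl n) (v : Cl r)
    (psi : Delta n r m) : Delta n r m :=
  [ffun x : Delta_basis n r m => \sum_(y : Delta_basis n r m) kappa gamma u x.1 y.1 *
     (\prod_(b < m) kappa delta v (x.2 b) (y.2 b)) * psi y].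

(* The three structure groups over SO(n) x SO(r), each the quotient of
   Spin(n) x Spin(r) by a group of pairs of signs; [sign_ker] tells which. *)
Inductive structure_group := SpinR | SpinSpin | SpinSO.

Definition sign_ker (G : structure_group) (s t : bool) : bool :=
  match G with
  | SpinR => s == t
  | SpinSpin => ~~ s && ~~ t
  | SpinSO => ~~ s
  end.

Definition same_class {n r} (G : structure_group)
    (u : Cl n) (v : Cl r) (u' : Cl n) (v' : Cl r) : Prop :=
  exists s t, [/\ sign_ker G s t, u' = (-1) ^+ s *: u & v' = (-1) ^+ t *: v].

End Clifford.

Section SpinGeometry.
Variables (R : realType) (n r m : nat) (M : topologicalType) (A : atlas R n M).
Variables (g : M -> tvec R M -> tvec R M -> R) (F : vbundle R M).

Local Notation TM := (tangent_bundle A g).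
Local Notation field := (M -> tvec R M).

(* A principal bundle over P_SO(M) x P_SO(F), given by local sections and
   transition functions: the section of index a projects to the frame
   ([st_e a], [st_f a]) over [st_dom a], and the section of index b is the one
   of index a multiplied by the class of ([st_u a b p], [st_v a b p]) in the
   structure group. *)
Record lift_data := LiftData {
  st_index : Type;
  st_dom : st_index -> set M;
  st_e : st_index -> 'I_n -> M -> tvec R M;
  st_f : st_index -> 'I_r -> M -> vb_carrier F;
  st_u : st_index -> st_index -> M -> Cl R n;
  st_v : st_index -> st_index -> M -> Cl R r }.

Definition change_e (st : lift_data) (a b : st_index st) (p : M) : 'M[R]_n :=
  \matrix_(i, j) g p (st_e a i p) (st_e b j p).

Definition change_f (st : lift_data) (a b : st_index st) (p : M) : 'M[R]_r :=
  \matrix_(k, l) vb_inner F p (st_f a k p) (st_f b l p).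

Record is_lift (posM : M -> ('I_n -> tvec R M) -> Prop)
    (posF : M -> ('I_r -> vb_carrier F) -> Prop)
    (G : structure_group) (st : lift_data) : Prop := {
  st_open : forall a : st_index st, open (st_dom a);
  st_cover : forall p, exists a : st_index st, st_dom a p;
  st_frame_e : forall a : st_index st,
    orthonormal_frame (E := TM) (st_dom a) (st_e a);
  st_frame_f : forall a : st_index st,
    orthonormal_frame (E := F) (st_dom a) (st_f a);
  st_pos_e : forall (a : st_index st) p, st_dom a p ->
    posM p (fun i => st_e a i p);
  st_pos_f : forall (a : st_index st) p, st_dom a p ->
    posF p (fun k => st_f a k p);
  st_spin : forall (a b : st_index st) p, st_dom a p -> st_dom b p ->
    Spin (st_u a b p) /\ Spin (st_v a b p);
  st_covers : forall (a b : st_index st) p, st_dom a p -> st_dom b p ->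
    covers (st_u a b p) (change_e a b p) /\
    covers (st_v a b p) (change_f a b p);
  st_cocycle : forall (a b c : st_index st) p,
    st_dom a p -> st_dom b p -> st_dom c p ->
    same_class G (cl_mul (st_u a b p) (st_u b c p))
                 (cl_mul (st_v a b p) (st_v b c p))
                 (st_u a c p) (st_v a c p);
  (* a smooth map to the quotient lifts locally to smooth maps *)
  st_smooth : forall (a b : st_index st) p, st_dom a p -> st_dom b p ->
    exists (W : set M) (u : M -> Cl R n) (v : M -> Cl R r),
      [/\ open W, W p, W `<=` st_dom a `&` st_dom b,
          (forall B, smooth_on A W (fun q => u q B)) /\
          (forall B, smooth_on A W (fun q => v q B)) &
          forall q, W q ->
            same_class G (st_u a b q) (st_v a b q) (u q) (v q)] }.

Definition spinr_structure posM posF := is_lift posM posF SpinR.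

(* The three cases in which S is globally defined; [tau] is the principal
   bundle to which S is associated. *)
Inductive spinor_bundle_from posM posF (sigma : lift_data)
    : lift_data -> Prop :=
  | from_spinr : odd m -> spinor_bundle_from posM posF sigma sigma
  | from_spin_spin tau : is_lift posM posF SpinSpin tau ->
      spinor_bundle_from posM posF sigma tau
  | from_spin_so tau : ~~ odd m -> is_lift posM posF SpinSO tau ->
      spinor_bundle_from posM posF sigma tau.

Variables (gamma : 'I_n -> 'M[R[i]]_(2 ^ n./2))
          (delta : 'I_r -> 'M[R[i]]_(2 ^ r./2)).
Variable tau : lift_data.

(* A vector of S at p is given by its components in all the sections of index a
   with [st_dom a p]; the other components are irrelevant. *)
Definition spinor := st_index tau -> Delta R n r m.

Definition spinor_section (phi : M -> spinor) : Prop :=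
  (forall (a : st_index tau) x,
     smooth_on A (st_dom a) (fun p => complex.Re (phi p a x)) /\
     smooth_on A (st_dom a) (fun p => complex.Im (phi p a x))) /\
  (forall (a b : st_index tau) p, st_dom a p -> st_dom b p ->
     phi p a = act_spin gamma delta (st_u a b p) (st_v a b p) (phi p b)).

Definition coord_e (a : st_index tau) (p : M) (v : tvec R M) : 'I_n -> R :=
  fun i => g p v (st_e a i p).

Definition coord_f (a : st_index tau) (p : M) (w : vb_carrier F) : 'I_r -> R :=
  fun k => vb_inner F p w (st_f a k p).

Definition clifford_mul (p : M) (v : tvec R M) (psi : spinor) : spinor :=
  fun a => act_left (kappa_vec gamma (coord_e a p v)) (psi a).

(* kappa^m_{r*}(w w') for orthogonal w, w' in F_p *)
Definition kappa_star (p : M) (w w' : vb_carrier F) (psi : spinor) : spinor :=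
  fun a => act_lie (kappa_vec delta (coord_f a p w) *m
                    kappa_vec delta (coord_f a p w')) (psi a).

Definition derive_spinor (v : tvec R M) (psi : M -> Delta R n r m)
    : Delta R n r m :=
  [ffun x => (v (fun q => complex.Re (psi q x)) +i*
              v (fun q => complex.Im (psi q x)))%C].

(* The connection induced on S: the connection form sum_(i<j) <nabla e_i, e_j>
   E_ij of P_SO(M) lifts to 1/2 sum_(i<j) <nabla e_i, e_j> e_i e_j, since
   lambda_n* (e_i e_j) = 2 E_ij, and similarly for F. *)
Definition nabla_theta (nablaM : connection_op R M (tvec R M))
    (nablaF : connection_op R M (vb_carrier F))
    : connection_op R M spinor := fun p v phi a =>
  derive_spinor v (fun q => phi q a)
  + 2^-1 *: (\sum_(i < n) \sum_(j < n | (i < j)%N)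
      ((g p (nablaM p v (st_e a i)) (st_e a j p))%:C)%C *:
        act_left (gamma i *m gamma j) (phi p a))
  + 2^-1 *: (\sum_(k < r) \sum_(l < r | (k < l)%N)
      ((vb_inner F p (nablaF p v (st_f a k)) (st_f a l p))%:C)%C *:
        act_lie (delta k *m delta l) (phi p a)).

End SpinGeometry.

(* Main.v *)
(* The local connection form of nabla^theta is 1/4 sum_ij w_ij e_i e_j on the
   first factor and 1/4 sum_kl eta_kl f_k f_l on the others, and w |-> 1/4
   sum_ij w_ij e_i e_j is a morphism of Lie algebras; hence the equation of
   structure gives R^theta (X, Y) = 1/4 sum_jk <R^M (X, Y) e_j, e_k> e_j e_k +
   1/4 sum_kl Theta_kl (X, Y) kappa_* (f_k f_l).  Put Y = e_i, multiply by e_i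
   and sum over i.  In the first term, rotating the factors of e_i e_j e_k
   cyclically only adds terms with i = j, i = k or j = k, whereas the cyclic sum of
   <R^M (X, e_i) e_j, e_k> over i, j, k vanishes by Bianchi's identity; so three
   times the term is minus the added ones, which are multiples of Ric(X).  The
   second term is the contraction of Theta_kl with X. *)

From HB Require Import structures.
Require Import Defs.
From mathcomp Require Import all_boot all_order all_algebra.
From mathcomp Require Import all_classical all_reals all_analysis.
From mathcomp Require Import complex.
From mathcomp Require Import ring lra.

Set Implicit Arguments.
Unset Strict Implicit.
Unset Printing Implicit Defensive.

Import Order.TTheory GRing.Theory Num.Theory numFieldNormedType.Exports.
Local Open Scope classical_set_scope.
Local Open Scope ring_scope.

(** * Smooth functions *)

(** A spinor is known through its components in the frames of the lift [tau], whereas [e] and [f]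
    are arbitrary orthonormal frames, not necessarily positive. So R^theta is computed in the frames
    of the lift, and Clifford multiplications by e_i and f_k, as matrices in those frames
    ([clifford_frame]), serve as new generators: orthonormality gives them the Clifford relations
    again, and the algebra is done for any such generators. Bianchi's identity permutes the first
    three arguments of <R^M (X, Y) Z, U>, but the contraction keeps X first and permutes the last
    three; the pair symmetry [Rm_pair] bridges the two. The rotations of e_i e_j e_k add 4 and 2
    copies of one vector, so that three times the term is -6 copies of it; the coefficient -2 and
    the factor 1/4 of the connection form make the -1/2 in front of Ric. Fields and sections are
    only local, and vectors are derivations of germs. Localisation multiplies by the indicator of a
    neighbourhood, which is smooth near the point, so no bump function occurs. *)

Lemma near_eq_differentiable (R : numFieldType) (V U : normedModType R)
    (f h : V -> U) (x : V) :
  (\forall y \near x, f y = h y) -> differentiable f x -> differentiable h x.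
Proof.
(* The difference [k] vanishes near [x], so it has differential 0 there, and [h] is [f + k]. *)
move=> fh df; pose k := h - f.
have dk : k \o shift x = cst (k x) + (\0 : V -> U) +o_ 0 id.
  apply/eqaddoP => _/posnumP[eps].
  have kx0 : k x = 0.
    by rewrite /k /= -[LHS]/(h x - f x) (nbhs_singleton fh) subrr.
  have [d d0 hd] := (iffLR (nbhs_ballP _ _) fh).
  apply/nbhs_ballP; exists d => // y /= xy.
  have -> : (k \o shift x - (cst (k x) + \0)) y = 0.
    rewrite kx0 -[LHS]/((h (y + x) - f (y + x)) - (0 + 0)).
    rewrite (hd (y + x)) ?subrr ?addr0 ?subrr//.
    by move: xy; rewrite -!ball_normE /= sub0r normrN opprD addrCA subrr addr0 normrN.
  by rewrite normr0 mulr_ge0.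
have -> : h = f + k by rewrite funeqE => y; rewrite /k -[RHS]/(f y + (h y - f y)) addrC subrK.
apply: differentiableD => //; apply/diff_locallyP.
have c0 : continuous (\0 : V -> U) by move=> ?; exact: cvg_cst.
by rewrite (diff_unique c0 dk).
Qed.

Section EuclideanSmoothness.
Variables (R : realType) (n : nat).
Implicit Types (V W : set 'rV[R]_n) (f h : 'rV[R]_n -> R).

Lemma Ck_sub k V W f : V `<=` W -> Ck k W f -> Ck k V f.
Proof.
elim: k f => [|k IH] f VW /=; first by move=> Hf x Vx; apply: Hf; exact: VW.
by case=> Hd Hp; split=> [x Vx|i]; [apply/Hd/VW | apply: IH].
Qed.

(** On an open set, equality on [V] is equality near each point of [V], and this passes to the
    partial derivatives. *)
Lemma Ck_congr k V f h : open V -> (forall x, V x -> f x = h x) ->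
  Ck k V f -> Ck k V h.
Proof.
move=> oV; have nV x : V x -> \forall y \near x, V y by move=> Vx; exact: open_nbhs_nbhs.
elim: k f h => [|k IH] f h fh /=.
  move=> fc x Vx; have hx : \forall y \near x, f y = h y.
    by near=> y; apply: fh; near: y; exact: nV.
  have fx : f y @[y --> x] --> h x by rewrite -(fh x Vx); exact: fc.
  exact: cvg_trans (near_eq_cvg hx) fx.
case=> df pf; split=> [x Vx|i].
  apply: near_eq_differentiable (df x Vx).
  by near=> y; apply: fh; near: y; exact: nV.
apply: IH (pf i) => x Vx; apply: near_eq_derive.
by near=> y; apply: fh; near: y; exact: nV.
Unshelve. all: by end_near. Qed.

Lemma Cinfty_differentiable V f x : Cinfty V f -> V x -> differentiable f x.
Proof. by move=> /(_ 1%N) [+ _]; apply. Qed.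

Lemma Cinfty_partial V f i : Cinfty V f -> Cinfty V (partial i f).
Proof. by move=> Hf k; have [_] := Hf k.+1; apply. Qed.

Lemma CkD k V f h : open V -> Ck k V f -> Ck k V h ->
  Ck k V (fun x => f x + h x).
Proof.
move=> oV; elim: k f h => [|k IH] f h /=.
  by move=> Hf Hh x Vx; apply: (@continuousD _ _ _ f h); auto.
move=> [df pf] [dh ph]; split=> [x Vx|i].
  by apply: (@differentiableD _ _ _ f h); auto.
apply: (Ck_congr oV _ (IH _ _ (pf i) (ph i))) => x Vx.
by rewrite /partial (@deriveD _ _ _ f h)//; apply: diff_derivable; auto.
Qed.

Lemma Cinfty_cst V (c : R) : Cinfty V (fun=> c).
Proof.
move=> k; elim: k c => [|k IH] c /=; first by move=> x _; exact: cst_continuous.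
split=> [x _|i]; first exact: differentiable_cst.
by have -> : partial i (fun=> c) = fun=> 0 :> R; [rewrite funeqE => x; exact: derive_cst|].
Qed.

Lemma CinftyD V f h : open V -> Cinfty V f -> Cinfty V h ->
  Cinfty V (fun x => f x + h x).
Proof. by move=> oV Hf Hh k; exact: CkD. Qed.

(** Leibniz' rule leaves one factor undifferentiated, so an induction on [Ck k] would need [Ck k.+1]
    to imply [Ck k]; with both factors in [Cinfty] the induction hypothesis applies directly. *)
Lemma CinftyM V f h : open V -> Cinfty V f -> Cinfty V h ->
  Cinfty V (fun x => f x * h x).
Proof.
move=> oV Hf Hh k; elim: k f h Hf Hh => [|k IH] f h Hf Hh /=.
  by move=> x Vx; apply: (@continuousM _ _ f h); [exact: (Hf 0%N)|exact: (Hh 0%N)].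
have df x : V x -> differentiable f x by move=> Vx; exact: Cinfty_differentiable Vx.
have dh x : V x -> differentiable h x by move=> Vx; exact: Cinfty_differentiable Vx.
split=> [x Vx|i]; first by apply: (@differentiableM _ _ f h); auto.
apply: (Ck_congr oV _ (CkD oV (IH _ _ Hf (Cinfty_partial i Hh))
                              (IH _ _ Hh (Cinfty_partial i Hf)))) => x Vx.
by rewrite /partial (@deriveM _ _ f h)//; apply: diff_derivable; auto.
Qed.

End EuclideanSmoothness.

(** * Germs of functions and vector fields *)

Section Germs.
Variables (R : realType) (n : nat) (M : topologicalType) (A : atlas R n M).
Hypothesis hM : smooth_manifold A.
Implicit Types (p q : M) (V W : set M) (f h : M -> R) (D : tvec R M).
Implicit Types X Y Z : M -> tvec R M.

Lemma chart_image_open (i : chart_index A) W : open W ->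
  open (chart i @` (chart_dom i `&` W)).
Proof.
move=> oW; rewrite openE => _ [p [dp Wp] <-].
have Wn : nbhs (chart_inv i (chart i p)) W.
  by rewrite (mfd_chartK hM dp); exact: open_nbhs_nbhs.
have dn : nbhs (chart i p) (chart i @` chart_dom i).
  by apply: open_nbhs_nbhs; split; [exact: (mfd_img_open hM)|exists p].
apply: filterS2 dn (mfd_inv_cont hM dp Wn) => _ [q dq <-] /=.
by rewrite (mfd_chartK hM dq) => Wq; exists q.
Qed.

Lemma smooth_on_sub V W f : V `<=` W -> smooth_on A W f -> smooth_on A V f.
Proof.
move=> VW Hf i k; apply: Ck_sub (Hf i k) => _ [q [dq Vq] <-].
by exists q => //; split=> //; exact: VW.
Qed.

Lemma smooth_on_congr W f h : open W -> (forall q, W q -> f q = h q) ->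
  smooth_on A W f -> smooth_on A W h.
Proof.
move=> oW fh Hf i k; apply: Ck_congr (Hf i k); first exact: chart_image_open.
by move=> _ [q [dq Wq] <-]; rewrite (mfd_chartK hM dq); exact: fh.
Qed.

Lemma smooth_on_cst W (c : R) : smooth_on A W (fun=> c).
Proof. by move=> i; exact: Cinfty_cst. Qed.

Lemma smooth_onD W f h : open W -> smooth_on A W f -> smooth_on A W h ->
  smooth_on A W (fun q => f q + h q).
Proof. by move=> oW Hf Hh i; apply: CinftyD; [exact: chart_image_open|..]. Qed.

Lemma smooth_onM W f h : open W -> smooth_on A W f -> smooth_on A W h ->
  smooth_on A W (fun q => f q * h q).
Proof. by move=> oW Hf Hh i; apply: CinftyM; [exact: chart_image_open|..]. Qed.

Lemma smooth_onB W f h : open W -> smooth_on A W f -> smooth_on A W h ->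
  smooth_on A W (fun q => f q - h q).
Proof.
move=> oW Hf Hh; apply: smooth_onD => //.
apply: (@smooth_on_congr _ (fun q => -1 * h q)) => // [q _|].
  by rewrite mulN1r.
by apply: smooth_onM => //; exact: smooth_on_cst.
Qed.

Lemma near_open p (P : M -> Prop) :
  (\forall q \near p, P q) -> exists V, [/\ open V, V p & forall q, V q -> P q].
Proof. by rewrite /prop_near1 nbhsE => -[V [oV Vp] VP]; exists V. Qed.

Lemma open_near p V : open V -> V p -> \forall q \near p, V q.
Proof. by move=> oV Vp; exact: open_nbhs_nbhs. Qed.

Lemma smooth_at_near p f : smooth_at A p f -> \forall q \near p, smooth_at A q f.
Proof.
move=> [W [oW Wp Hf]]; apply: filterS (open_near oW Wp) => q Wq.
by exists W.
Qed.

Lemma smooth_at_congr p f h : (\forall q \near p, f q = h q) ->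
  smooth_at A p f -> smooth_at A p h.
Proof.
move=> /near_open[V [oV Vp fh]] [W [oW Wp Hf]]; exists (V `&` W).
split=> //; first exact: openI.
apply: (@smooth_on_congr _ f); first exact: openI.
  by move=> q [Vq _]; exact: fh.
by apply: smooth_on_sub Hf; exact: subIsetr.
Qed.

Lemma smooth_at2 p f h : smooth_at A p f -> smooth_at A p h ->
  exists V, [/\ open V, V p, smooth_on A V f & smooth_on A V h].
Proof.
move=> [V [oV Vp Hf]] [W [oW Wp Hh]]; exists (V `&` W); split=> //.
- exact: openI.
- by apply: smooth_on_sub Hf; exact: subIsetl.
- by apply: smooth_on_sub Hh; exact: subIsetr.
Qed.

Lemma smooth_at_cst p (c : R) : smooth_at A p (fun=> c).
Proof. by exists setT; split=> //; [exact: openT|exact: smooth_on_cst]. Qed.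

Lemma smooth_atD p f h : smooth_at A p f -> smooth_at A p h ->
  smooth_at A p (fun q => f q + h q).
Proof.
move=> Hf Hh; have [V [oV Vp Vf Vh]] := smooth_at2 Hf Hh.
by exists V; split=> //; exact: smooth_onD.
Qed.

Lemma smooth_atM p f h : smooth_at A p f -> smooth_at A p h ->
  smooth_at A p (fun q => f q * h q).
Proof.
move=> Hf Hh; have [V [oV Vp Vf Vh]] := smooth_at2 Hf Hh.
by exists V; split=> //; exact: smooth_onM.
Qed.

Lemma smooth_atB p f h : smooth_at A p f -> smooth_at A p h ->
  smooth_at A p (fun q => f q - h q).
Proof.
move=> Hf Hh; have [V [oV Vp Vf Vh]] := smooth_at2 Hf Hh.
by exists V; split=> //; exact: smooth_onB.
Qed.

Lemma smooth_at_sum p (I : Type) (s : seq I) (f : I -> M -> R) :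
  (forall i, smooth_at A p (f i)) -> smooth_at A p (fun q => \sum_(i <- s) f i q).
Proof.
move=> Hf; elim: s => [|i s IH].
  by apply: smooth_at_congr (smooth_at_cst p 0); apply: nearW => q; rewrite big_nil.
apply: smooth_at_congr (smooth_atD (Hf i) IH).
by apply: nearW => q; rewrite big_cons.
Qed.

(* The indicator function of a neighbourhood of [p] is idempotent and smooth
   near [p], hence killed by every derivation at [p]. *)
Lemma tangent_indic p D V : tangent A p D -> open V -> V p ->
  smooth_at A p (fun q => (q \in V)%:R) /\ D (fun q => (q \in V)%:R) = 0.
Proof.
move=> tD oV Vp; pose chi q : R := (q \in V)%:R.
have Hchi : smooth_at A p chi.
  apply: smooth_at_congr (smooth_at_cst p 1).
  by apply: filterS (open_near oV Vp) => q Vq; rewrite /chi mem_set.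
split=> //; have chi2 : (fun q => chi q * chi q) = chi.
  by rewrite funeqE => q; rewrite /chi; case: (q \in V); rewrite ?mulr1 ?mulr0.
have := tan_mul tD Hchi Hchi; rewrite chi2 /chi mem_set// mul1r -/chi.
by move=> /eqP; rewrite -subr_eq subrr eq_sym => /eqP.
Qed.

(** Multiplication by the indicator of a neighbourhood where [f] and [h] agree makes them equal
    everywhere and does not change the value of [D]. If one of them is not smooth near [p], neither
    is the other, and both values are the default 0. *)
Lemma tangent_congr p D f h : tangent A p D ->
  (\forall q \near p, f q = h q) -> D f = D h.
Proof.
move=> tD fh; have [Hf|Hf] := pselect (smooth_at A p f); last first.
  rewrite !(tan_default tD)// => Hh; apply: Hf; apply: smooth_at_congr Hh.
  by apply: filterS fh => q.
have Hh := smooth_at_congr fh Hf.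
have [V [oV Vp Vfh]] := near_open fh.
have [Hchi Dchi] := tangent_indic tD oV Vp.
have cut k : smooth_at A p k -> D k = D (fun q => (q \in V)%:R * k q).
  by move=> Hk; rewrite (tan_mul tD)// Dchi mulr0 addr0 mem_set// mul1r.
rewrite (cut _ Hf) (cut _ Hh); congr (D _); rewrite funeqE => q.
have [Vq|] := boolP (q \in V); last by rewrite !mul0r.
by rewrite Vfh//; exact: set_mem.
Qed.

Lemma tangent_cst p D (c : R) : tangent A p D -> D (fun=> c) = 0.
Proof.
move=> tD; have one := smooth_at_cst p 1.
(* From 1 = 1 * 1, the derivation rule gives D 1 = D 1 + D 1. *)
have D1 : D (fun=> 1) = 0.
  have := tan_mul tD one one; rewrite mulr1 mul1r.
  by move=> /eqP; rewrite -subr_eq subrr eq_sym => /eqP.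
have -> : (fun=> c) = (fun q : M => c * (fun=> 1) q).
  by rewrite funeqE => q; rewrite mulr1.
by rewrite (tan_scale tD)// D1 mulr0.
Qed.

Lemma tangentB_fun p D f h : tangent A p D -> smooth_at A p f ->
  smooth_at A p h -> D (fun q => f q - h q) = D f - D h.
Proof.
move=> tD Hf Hh; apply/eqP; rewrite eq_sym subr_eq; apply/eqP.
rewrite -(tan_add tD (smooth_atB Hf Hh) Hh); congr (D _).
by rewrite funeqE => q; rewrite subrK.
Qed.

Lemma tangent_sum p D (I : Type) (s : seq I) (f : I -> M -> R) :
  tangent A p D -> (forall i, smooth_at A p (f i)) ->
  D (fun q => \sum_(i <- s) f i q) = \sum_(i <- s) D (f i).
Proof.
move=> tD Hf; elim: s => [|i s IH].
  rewrite big_nil; transitivity (D (fun=> 0)); last exact: tangent_cst tD.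
  by congr (D _); apply/funext => q; rewrite big_nil.
rewrite big_cons -IH -(tan_add tD (Hf i) (smooth_at_sum s Hf)); congr (D _).
by rewrite funeqE => q; rewrite big_cons.
Qed.

Lemma tangent0 p : tangent A p (0 : tvec R M).
Proof.
have E f : (0 : tvec R M) f = 0 by [].
by split=> [f h _ _|c f _|f h _ _|f _]; rewrite !E ?mulr0 ?addr0.
Qed.

Lemma tangentZD p (c : R) D1 D2 : tangent A p D1 -> tangent A p D2 ->
  tangent A p (c *: D1 + D2 : tvec R M).
Proof.
move=> t1 t2.
have E f : (c *: D1 + D2 : tvec R M) f = c * D1 f + D2 f by [].
split=> [f h Hf Hh|a f Hf|f h Hf Hh|f Hf]; rewrite !E.
- by rewrite (tan_add t1)// (tan_add t2)//; ring.
- by rewrite (tan_scale t1)// (tan_scale t2)//; ring.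
- by rewrite (tan_mul t1)// (tan_mul t2)//; ring.
- by rewrite (tan_default t1)// (tan_default t2)// mulr0 addr0.
Qed.

(** For [tangent_bundle A g] this is convertible to [section_at], so facts about sections near a
    point apply to vector fields as they stand. *)
Definition field_at p X := exists W, [/\ open W, W p & vector_field A W X].

Lemma vector_field_sub V W X : V `<=` W -> vector_field A W X -> vector_field A V X.
Proof.
move=> VW [tX sX]; split=> [q Vq|U f oU UV]; first exact/tX/VW.
by apply: sX => //; exact: subset_trans VW.
Qed.

Lemma field_at_near p X : field_at p X -> \forall q \near p, field_at q X.
Proof.
by move=> [W [oW Wp HX]]; apply: filterS (open_near oW Wp) => q Wq; exists W.
Qed.

Lemma field_at2 p X Y : field_at p X -> field_at p Y ->
  exists W, [/\ open W, W p, vector_field A W X & vector_field A W Y].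
Proof.
move=> [V [oV Vp HX]] [W [oW Wp HY]]; exists (V `&` W); split=> //.
- exact: openI.
- by apply: vector_field_sub HX; exact: subIsetl.
- by apply: vector_field_sub HY; exact: subIsetr.
Qed.

Lemma field_at_tangent p X : field_at p X -> tangent A p (X p).
Proof. by move=> [W [oW Wp [tX _]]]; exact: tX. Qed.

Lemma field_at_smooth p X f : field_at p X -> smooth_at A p f ->
  smooth_at A p (fun q => X q f).
Proof.
move=> [W [oW Wp [tX sX]]] [V [oV Vp Hf]]; exists (V `&` W); split=> //.
  exact: openI.
apply: sX; [exact: openI|exact: subIsetr|].
by apply: smooth_on_sub Hf; exact: subIsetl.
Qed.

Lemma lieE p X Y f : smooth_at A p f ->
  lie A X Y p f = X p (fun q => Y q f) - Y p (fun q => X q f).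
Proof. by move=> Hf; rewrite /lie; case: asboolP. Qed.

Lemma field_at_add p X Y f h : field_at p X -> field_at p Y ->
  smooth_at A p f -> smooth_at A p h ->
  X p (fun q => Y q (fun q' => f q' + h q')) =
  X p (fun q => Y q f) + X p (fun q => Y q h).
Proof.
move=> HX HY Hf Hh; have tX := field_at_tangent HX.
rewrite -(tan_add tX) //; try exact: field_at_smooth.
(* [Y q] is additive on these functions only for [q] near [p], where they remain smooth; [X p] sees
   nothing else. *)
apply: tangent_congr tX _; near=> q.
have HYq : field_at q Y by near: q; exact: field_at_near.
rewrite (tan_add (field_at_tangent HYq))//; near: q; exact: smooth_at_near.
Unshelve. all: by end_near. Qed.

Lemma field_at_scale p X Y c f : field_at p X -> field_at p Y ->
  smooth_at A p f ->
  X p (fun q => Y q (fun q' => c * f q')) = c * X p (fun q => Y q f).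
Proof.
move=> HX HY Hf; have tX := field_at_tangent HX.
rewrite -(tan_scale tX) //; try exact: field_at_smooth.
apply: tangent_congr tX _; near=> q.
have HYq : field_at q Y by near: q; exact: field_at_near.
rewrite (tan_scale (field_at_tangent HYq))//; near: q; exact: smooth_at_near.
Unshelve. all: by end_near. Qed.

Lemma field_at_mul p X Y f h : field_at p X -> field_at p Y ->
  smooth_at A p f -> smooth_at A p h ->
  X p (fun q => Y q (fun q' => f q' * h q')) =
  f p * X p (fun q => Y q h) + X p f * Y p h +
  (h p * X p (fun q => Y q f) + X p h * Y p f).
Proof.
move=> HX HY Hf Hh; have tX := field_at_tangent HX.
have Yf := field_at_smooth HY Hf; have Yh := field_at_smooth HY Hh.
transitivity (X p (fun q => f q * Y q h + h q * Y q f)).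
  apply: tangent_congr tX _; near=> q.
  have HYq : field_at q Y by near: q; exact: field_at_near.
  rewrite (tan_mul (field_at_tangent HYq))//; near: q; exact: smooth_at_near.
rewrite (tan_add tX); [|exact: smooth_atM..].
by rewrite !(tan_mul tX)//; ring.
Unshelve. all: by end_near. Qed.

(** The bracket is a derivation because the cross terms in [field_at_mul] are symmetric in [X] and
    [Y]. *)
Lemma lie_tangent p X Y : field_at p X -> field_at p Y -> tangent A p (lie A X Y p).
Proof.
move=> HX HY; split=> [f h Hf Hh|c f Hf|f h Hf Hh|f Hf].
- by rewrite !lieE//; [rewrite !field_at_add//; ring|exact: smooth_atD].
- rewrite !lieE//; last by apply: smooth_atM => //; exact: smooth_at_cst.
  by rewrite !field_at_scale//; ring.
- by rewrite !lieE//; [rewrite !field_at_mul//; ring|exact: smooth_atM].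
- by rewrite /lie; case: asboolP.
Qed.

Lemma vector_field_lie W X Y : open W -> vector_field A W X ->
  vector_field A W Y -> vector_field A W (lie A X Y).
Proof.
move=> oW HX HY; split=> [q Wq|V f oV VW Hf].
  by apply: lie_tangent; exists W.
have [[_ sX] [_ sY]] := (HX, HY).
apply: (@smooth_on_congr _ (fun p => X p (fun q => Y q f) - Y p (fun q => X q f))) => //.
  by move=> q Vq; rewrite lieE//; exists V.
by apply: smooth_onB => //; [apply: sX|apply: sY] => //; [apply: sY|apply: sX].
Qed.

Lemma field_at_lie p X Y : field_at p X -> field_at p Y -> field_at p (lie A X Y).
Proof.
move=> HX HY; have [W [oW Wp WX WY]] := field_at2 HX HY.
by exists W; split=> //; exact: vector_field_lie.
Qed.

Lemma vector_fieldD W X Y : open W -> vector_field A W X ->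
  vector_field A W Y -> vector_field A W (fun q => X q + Y q).
Proof.
move=> oW [tX sX] [tY sY]; split=> [q Wq|V f oV VW Hf].
  by rewrite -[X q]scale1r; apply: tangentZD; auto.
by apply: smooth_onD => //; [exact: sX|exact: sY].
Qed.

Lemma lieC p X Y : field_at p X -> field_at p Y -> lie A X Y p = - lie A Y X p.
Proof.
move=> HX HY; rewrite funeqE => f.
rewrite -[RHS]/(- (lie A Y X p f)).
have [Hf|Hf] := pselect (smooth_at A p f); first by rewrite !lieE// opprB.
by rewrite !(tan_default (lie_tangent _ _) Hf)// oppr0.
Qed.

Lemma lie_jacobi p X Y Z : field_at p X -> field_at p Y -> field_at p Z ->
  lie A X (lie A Y Z) p + lie A Y (lie A Z X) p + lie A Z (lie A X Y) p = 0.
Proof.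
move=> HX HY HZ; rewrite funeqE => f.
rewrite -[LHS]/(lie A X (lie A Y Z) p f + lie A Y (lie A Z X) p f
  + lie A Z (lie A X Y) p f) -[RHS]/(0 : R).
have [Hf|Hf] := pselect (smooth_at A p f); last first.
  by rewrite !(tan_default (lie_tangent _ (field_at_lie _ _)) Hf)// !addr0.
(* Each double bracket consists of four triple derivatives; the twelve of them cancel in pairs. *)
have expand T T' T'' : field_at p T -> field_at p T' -> field_at p T'' ->
    lie A T (lie A T' T'') p f =
    T p (fun q => T' q (fun q' => T'' q' f)) - T p (fun q => T'' q (fun q' => T' q' f))
    - (T' p (fun q => T'' q (fun q' => T q' f)) - T'' p (fun q => T' q (fun q' => T q' f))).
  move=> HT HT' HT''; rewrite lieE// (lieE _ _ (field_at_smooth HT Hf)).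
  rewrite -(tangentB_fun (field_at_tangent HT));
    [|by do 2?apply: field_at_smooth..].
  congr (_ - _); apply: tangent_congr (field_at_tangent HT) _.
  apply: filterS (smooth_at_near Hf) => q Hfq; exact: lieE.
by rewrite !expand//; ring.
Qed.

End Germs.

(** * Metric connections and their curvature *)

Section InnerProduct.
Variables (R : realType) (E : lmodType R) (S : set E) (b : E -> E -> R).
Hypotheses (hb : inner_product S b) (S0 : S 0).
Hypothesis SL : forall (c : R) v w, S v -> S w -> S (c *: v + w).
Implicit Types u v w : E.

Lemma fiberZ (c : R) v : S v -> S (c *: v).
Proof. by move=> Sv; rewrite -[_ *: _]addr0; exact: SL. Qed.

Lemma fiberD v w : S v -> S w -> S (v + w).
Proof. by move=> Sv Sw; rewrite -[v]scale1r; exact: SL. Qed.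

Lemma fiberB v w : S v -> S w -> S (v - w).
Proof. by move=> Sv Sw; rewrite addrC -scaleN1r; exact: SL. Qed.

Lemma fiber_sum (I : Type) (s : seq I) (f : I -> E) :
  (forall i, S (f i)) -> S (\sum_(i <- s) f i).
Proof. by move=> Sf; elim/big_ind: _ => // v w; exact: fiberD. Qed.

Lemma inner0l w : S w -> b 0 w = 0.
Proof. by move=> Sw; rewrite -(scale0r w) (ip_scale hb)// mul0r. Qed.

Lemma innerBl u v w : S u -> S v -> S w -> b (u - v) w = b u w - b v w.
Proof.
move=> Su Sv Sw; rewrite (ip_add hb)//; last by rewrite -scaleN1r; exact: fiberZ.
by rewrite -scaleN1r (ip_scale hb)// mulN1r.
Qed.

Lemma inner_suml (I : Type) (s : seq I) (f : I -> E) w :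
  (forall i, S (f i)) -> S w -> b (\sum_(i <- s) f i) w = \sum_(i <- s) b (f i) w.
Proof.
move=> Sf Sw; elim: s => [|i s IH]; last first.
  by rewrite !big_cons (ip_add hb) ?IH//; exact: fiber_sum.
by rewrite !big_nil inner0l.
Qed.

Lemma inner_sumZl (I : finType) (c : I -> R) (f : I -> E) w :
  (forall i, S (f i)) -> S w -> b (\sum_i c i *: f i) w = \sum_i c i * b (f i) w.
Proof.
move=> Sf Sw; rewrite inner_suml//; last by move=> i; exact: fiberZ.
by apply: eq_bigr => i _; rewrite (ip_scale hb).
Qed.

Variables (k : nat) (e : 'I_k -> E).
Hypotheses (Se : forall i, S (e i)) (eON : forall i j, b (e i) (e j) = (i == j)%:R).
Hypothesis espan : forall v, S v -> exists c : 'I_k -> R, v = \sum_i c i *: e i.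

Lemma onb_expand v : S v -> v = \sum_i b v (e i) *: e i.
Proof.
move=> Sv; have [c vE] := espan Sv; rewrite {1}vE; apply: eq_bigr => j _.
congr (_ *: _); rewrite vE inner_sumZl// (bigD1 j)//= eON eqxx mulr1 big1 ?addr0//.
by move=> i ij; rewrite eON (negPf ij) mulr0.
Qed.

Lemma onb_parseval v w : S v -> S w -> b v w = \sum_i b v (e i) * b w (e i).
Proof.
move=> Sv Sw; rewrite {1}(onb_expand Sv) inner_sumZl//.
by apply: eq_bigr => i _; rewrite (ip_sym hb (Se i) Sw).
Qed.

End InnerProduct.

(** * Sections near a point, metric connections and curvature *)

Section BundleGerms.
Variables (R : realType) (n : nat) (M : topologicalType) (A : atlas R n M).
Hypothesis hM : smooth_manifold A.
Implicit Types (p q : M) (V W : set M).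

(** What the study of curvature uses of a bundle near a point. It holds for [F] by local triviality
    and for the tangent bundle directly from the metric, so that both connections are treated by the
    same lemmas. *)
Record germ_bundle (E : vbundle R M) : Prop := {
  gb_zero : forall p, vb_fiber E p 0;
  gb_linear : forall p (c : R) v w, vb_fiber E p v -> vb_fiber E p w ->
    vb_fiber E p (c *: v + w);
  gb_ip : forall p, inner_product (vb_fiber E p) (vb_inner E p);
  gb_restrict : forall V W s, open V -> V `<=` W -> open W -> vb_section E W s -> vb_section E V s;
  gb_fiber : forall p (s : M -> vb_carrier E), section_at p s -> vb_fiber E p (s p);
  gb_inner : forall p (s t : M -> vb_carrier E), section_at p s -> section_at p t ->
    smooth_at A p (fun q => vb_inner E q (s q) (t q)) }.

Lemma tangent_germ_bundle g : riemannian_metric A g -> germ_bundle (tangent_bundle A g).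
Proof.
move=> hg; split.
- by move=> p; exact: tangent0.
- by move=> p; exact: tangentZD.
- exact: (rm_inner hg).
- by move=> V W s oV VW oW; exact: vector_field_sub.
- by move=> p s; exact: field_at_tangent.
- move=> p s t Hs Ht; have [W [oW Wp WX WY]] := field_at2 Hs Ht.
  by exists W; split=> //; exact: (rm_smooth hg).
Qed.

Lemma riemannian_germ_bundle k (E : vbundle R M) :
  riemannian_bundle A k E -> germ_bundle E.
Proof.
move=> hE; have restrict V W s : open V -> V `<=` W -> open W ->
    vb_section E W s -> vb_section E V s.
  by move=> oV VW oW; exact: (rb_restrict hE).
have fib p (s : M -> vb_carrier E) : section_at p s -> vb_fiber E p (s p).
  move=> [W [oW Wp Ws]]; have [V [e [oV Vp _ Vsec]]] := rb_trivial hE p.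
  have /Vsec[| |+ _] := restrict _ _ _ (openI oV oW) (@subIsetr _ V W) oW Ws.
  - exact: openI.
  - exact: subIsetl.
  - by apply.
split=> //; [exact: (rb_zero hE)|exact: (rb_linear hE)|exact: (rb_inner hE)|].
move=> p s t [W1 [oW1 W1p s1]] [W2 [oW2 W2p t2]].
have [V [e [oV Vp He Vsec]]] := rb_trivial hE p.
pose U := V `&` (W1 `&` W2).
have oU : open U by apply: openI => //; exact: openI.
have UV : U `<=` V by exact: subIsetl.
have /(Vsec U s oU UV)[sF sS] : vb_section E U s.
  by apply: restrict s1 => // q [_ []].
have /(Vsec U t oU UV)[tF tS] : vb_section E U t.
  by apply: restrict t2 => // q [_ []].
have eF i q : U q -> vb_fiber E q (e i q).
  by move=> Uq; apply: fib; exists V; split=> //; [exact: UV|exact: (onf_section He)].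
(* In a trivialising frame, Parseval's formula writes the inner product as a sum of products of the
   components, which are smooth. *)
apply: (@smooth_at_congr _ _ _ _ hM _
    (fun q => \sum_i vb_inner E q (s q) (e i q) * vb_inner E q (t q) (e i q))).
  have Up : U p by [].
  apply: filterS (open_near oU Up) => q Uq; apply/esym.
  apply: (onb_parseval (rb_inner hE q) (rb_zero hE q) (rb_linear hE (p := q))) => //.
  - by move=> i; exact: eF.
  - by apply: (onf_orthonormal He); exact: UV.
  - by apply: (onf_span He); exact: UV.
  - exact: sF.
  - exact: tF.
apply: smooth_at_sum => // i; exists U; split=> //.
exact: smooth_onM.
Qed.

Section Connection.
Variables (E : vbundle R M) (nabla : connection_op R M (vb_carrier E)).
Hypotheses (gE : germ_bundle E) (hnabla : metric_connection A nabla).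
Implicit Types (X Y : M -> tvec R M) (s t : M -> vb_carrier E).

Local Notation inner p := (vb_inner E p).

Lemma section_at_near p s : section_at p s -> \forall q \near p, section_at q s.
Proof.
by move=> [W [oW Wp Ws]]; apply: filterS (open_near oW Wp) => q Wq; exists W.
Qed.

Lemma section_at_nabla p Y s : field_at A p Y -> section_at p s ->
  section_at p (fun q => nabla q (Y q) s).
Proof.
move=> [V [oV Vp HY]] [W [oW Wp Ws]]; exists (V `&` W).
have oVW := openI oV oW; split=> //; apply: (conn_smooth hnabla) => //.
  by apply: vector_field_sub HY; exact: subIsetl.
by apply: (gb_restrict gE) Ws => //; exact: subIsetr.
Qed.

(* Locality is Leibniz' rule for the indicator function of a neighbourhood. *)
Lemma nabla_congr p D s t : tangent A p D -> section_at p s -> section_at p t ->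
  (\forall q \near p, s q = t q) -> nabla p D s = nabla p D t.
Proof.
move=> tD Hs Ht /near_open[V [oV Vp st]].
have [Hchi Dchi] := tangent_indic hM tD oV Vp.
have cut u : section_at p u ->
    nabla p D u = nabla p D (fun q => (q \in V)%:R *: u q).
  move=> Hu; rewrite (conn_leibniz hnabla)// Dchi.
  by rewrite [X in X *: _]/(0 : R) scale0r add0r mem_set// scale1r.
rewrite (cut _ Hs) (cut _ Ht); congr (nabla _ _ _); apply/funext => q.
have [Vq|] := boolP (q \in V); last by rewrite !scale0r.
by rewrite st//; exact: set_mem.
Qed.

Lemma nabla_fiber p D s : tangent A p D -> section_at p s -> vb_fiber E p (nabla p D s).
Proof. exact: (conn_fiber hnabla). Qed.

Lemma curvature_fiber p X Y s : field_at A p X -> field_at A p Y ->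
  section_at p s -> vb_fiber E p (curvature A nabla X Y s p).
Proof.
move=> HX HY Hs; have [tX tY] := (field_at_tangent HX, field_at_tangent HY).
have fB := fiberB (gb_linear gE (p := p)).
apply: (fB _ _ (fB _ _ _ _)); apply: nabla_fiber => //; try exact: section_at_nabla.
exact: lie_tangent.
Qed.

Lemma curvatureC p X Y s : field_at A p X -> field_at A p Y -> section_at p s ->
  curvature A nabla X Y s p = - curvature A nabla Y X s p.
Proof.
move=> HX HY Hs; rewrite /curvature (lieC hM HY HX).
have tXY := lie_tangent hM HX HY.
(* Linearity in the direction is stated for combinations [c *: v + w]; with [c = 1] and zero vectors
   it gives the value 0 at the zero vector, and then [c = -1] gives the sign. *)
have t0 : tangent A p (0 : tvec R M) := tangent0 _ _.
have lin0 : nabla p 0 s = 0.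
  have := conn_linearl hnabla 1 t0 t0 Hs; rewrite scaler0 addr0 scale1r.
  by move=> /eqP; rewrite -subr_eq subrr eq_sym => /eqP.
have := conn_linearl hnabla (-1) tXY t0 Hs.
by rewrite lin0 !addr0 !scaleN1r => ->; rewrite !opprB addrC.
Qed.

Lemma metric_second_derivative p X Y s t : field_at A p X -> field_at A p Y ->
  section_at p s -> section_at p t ->
  X p (fun q => inner q (nabla q (Y q) s) (t q)) =
  inner p (nabla p (X p) (fun q => nabla q (Y q) s)) (t p) +
  inner p (nabla p (Y p) s) (nabla p (X p) t).
Proof.
move=> HX HY Hs Ht.
exact: (conn_metric hnabla (field_at_tangent HX) (section_at_nabla HY Hs) Ht).
Qed.

Lemma metric_field_derivative p X Y s t : field_at A p X -> field_at A p Y ->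
  section_at p s -> section_at p t ->
  X p (fun q => Y q (fun q' => inner q' (s q') (t q'))) =
  X p (fun q => inner q (nabla q (Y q) s) (t q)) +
  X p (fun q => inner q (nabla q (Y q) t) (s q)).
Proof.
move=> HX HY Hs Ht; have tX := field_at_tangent HX.
have [HYs HYt] := (section_at_nabla HY Hs, section_at_nabla HY Ht).
rewrite -(tan_add tX); [|exact: (gb_inner gE)..].
apply: (tangent_congr hM tX); near=> q.
have HYq : field_at A q Y by near: q; exact: field_at_near.
have Hsq : section_at q s by near: q; exact: section_at_near.
have Htq : section_at q t by near: q; exact: section_at_near.
have tYq := field_at_tangent HYq.
rewrite (conn_metric hnabla tYq Hsq Htq); congr (_ + _).
apply: (ip_sym (gb_ip gE q)); first exact: (gb_fiber gE).
exact: nabla_fiber.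
Unshelve. all: by end_near. Qed.

(** Compatibility with the metric trades second covariant derivatives for derivatives of functions.
    Both the antisymmetry of the curvature and the structure equation are read off from this
    form. *)
Lemma curvature_innerE p X Y s t : field_at A p X -> field_at A p Y ->
  section_at p s -> section_at p t ->
  inner p (curvature A nabla X Y s p) (t p) =
  X p (fun q => inner q (nabla q (Y q) s) (t q)) -
  Y p (fun q => inner q (nabla q (X q) s) (t q)) -
  inner p (nabla p (lie A X Y p) s) (t p) +
  (inner p (nabla p (X p) s) (nabla p (Y p) t) -
   inner p (nabla p (Y p) s) (nabla p (X p) t)).
Proof.
move=> HX HY Hs Ht; have [tX tY] := (field_at_tangent HX, field_at_tangent HY).
have tXY := lie_tangent hM HX HY.
have ft := gb_fiber gE Ht.
have fXY := nabla_fiber tX (section_at_nabla HY Hs).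
have fYX := nabla_fiber tY (section_at_nabla HX Hs).
have fB := fiberB (gb_linear gE (p := p)).
have iB := innerBl (gb_ip gE p) (gb_zero gE p) (gb_linear gE (p := p)).
rewrite !metric_second_derivative// /curvature !iB//; last 2 first.
- exact: fB.
- exact: nabla_fiber.
ring.
Qed.

(** When [curvature_innerE] is added for (s, t) and (t, s), the products of first derivatives
    cancel; the rest vanishes because the bracket acts on the function <s, t> as XY - YX. *)
Lemma curvature_anti p X Y s t : field_at A p X -> field_at A p Y ->
  section_at p s -> section_at p t ->
  inner p (curvature A nabla X Y s p) (t p) =
  - inner p (curvature A nabla X Y t p) (s p).
Proof.
move=> HX HY Hs Ht; have [tX tY] := (field_at_tangent HX, field_at_tangent HY).
have tXY := lie_tangent hM HX HY.
have Hst := gb_inner gE Hs Ht.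
have := lieE X Y Hst; rewrite (conn_metric hnabla tXY Hs Ht).
rewrite (ip_sym (gb_ip gE p) (gb_fiber gE Hs) (nabla_fiber tXY Ht)).
rewrite !metric_field_derivative// => lieXY.
rewrite !curvature_innerE//.
rewrite (ip_sym (gb_ip gE p) (nabla_fiber tX Ht) (nabla_fiber tY Hs)).
rewrite (ip_sym (gb_ip gE p) (nabla_fiber tY Ht) (nabla_fiber tX Hs)).
move: lieXY; lra.
Qed.

End Connection.
End BundleGerms.

(** * Connection and curvature forms in an orthonormal frame *)

Section Frames.
Variables (R : realType) (n : nat) (M : topologicalType) (A : atlas R n M).
Hypothesis hM : smooth_manifold A.
Variable E : vbundle R M.
Hypothesis gE : germ_bundle A E.
Local Notation inner p := (vb_inner E p).

Variables (k : nat) (W : set M) (f : 'I_k -> M -> vb_carrier E) (p : M).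
Hypotheses (oW : open W) (Wp : W p) (hf : orthonormal_frame W f).

Lemma frame_section i : section_at p (f i).
Proof. by exists W; split=> //; exact: (onf_section hf). Qed.

Lemma frame_fiber i : vb_fiber E p (f i p).
Proof. exact/(gb_fiber gE)/frame_section. Qed.

Lemma frame_parseval v w : vb_fiber E p v -> vb_fiber E p w ->
  inner p v w = \sum_i inner p v (f i p) * inner p w (f i p).
Proof.
apply: (onb_parseval (gb_ip gE p) (gb_zero gE p) (gb_linear gE (p := p)) frame_fiber).
- exact: (onf_orthonormal hf).
- exact: (onf_span hf).
Qed.

Variable nabla : connection_op R M (vb_carrier E).
Hypothesis hnabla : metric_connection A nabla.
Variables X Y : M -> tvec R M.
Hypotheses (HX : field_at A p X) (HY : field_at A p Y).

(* Tensoriality in the differentiated argument comes for free from the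
   antisymmetry [curvature_anti]. *)
Lemma curvature_frame s t : section_at p s -> section_at p t ->
  inner p (curvature A nabla X Y s p) (t p) =
  \sum_i \sum_j inner p (s p) (f i p) * inner p (t p) (f j p) *
    inner p (curvature A nabla X Y (f i) p) (f j p).
Proof.
have expandr u v : section_at p u -> section_at p v ->
    inner p (curvature A nabla X Y u p) (v p) =
    \sum_j inner p (v p) (f j p) * inner p (curvature A nabla X Y u p) (f j p).
  move=> Hu Hv; rewrite frame_parseval; last exact: (gb_fiber gE).
    by apply: eq_bigr => j _; rewrite mulrC.
  exact: (curvature_fiber hM gE hnabla).
move=> Hs Ht; have Hf := frame_section.
rewrite (curvature_anti hM gE hnabla)// expandr// -sumrN; apply: eq_bigr => i _.
rewrite (curvature_anti hM gE hnabla)// mulrN opprK expandr// mulr_sumr.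
by apply: eq_bigr => j _; rewrite mulrA.
Qed.

(** This is [curvature_innerE] on frame fields. The terms outside the sum are the exterior
    derivative of the connection form, by its formula for arbitrary fields [X] and [Y]; the sum
    comes from Parseval's formula. *)
Lemma structure_equation i j :
  inner p (curvature A nabla X Y (f i) p) (f j p) =
  X p (fun q => inner q (nabla q (Y q) (f i)) (f j q)) -
  Y p (fun q => inner q (nabla q (X q) (f i)) (f j q)) -
  inner p (nabla p (lie A X Y p) (f i)) (f j p) +
  \sum_l (inner p (nabla p (X p) (f i)) (f l p) *
            inner p (nabla p (Y p) (f j)) (f l p) -
          inner p (nabla p (Y p) (f i)) (f l p) *
            inner p (nabla p (X p) (f j)) (f l p)).
Proof.
have [tX tY] := (field_at_tangent HX, field_at_tangent HY); have Hf := frame_section.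
rewrite (curvature_innerE hM gE hnabla)// sumrB; congr (_ + (_ - _));
  by apply: frame_parseval; exact: (nabla_fiber hnabla).
Qed.

(** The inner product of [f i] and [f j] is constant near [p], so its derivative vanishes. *)
Lemma connection_form_anti D i j : tangent A p D ->
  inner p (nabla p D (f i)) (f j p) = - inner p (nabla p D (f j)) (f i p).
Proof.
move=> tD; have Hf := frame_section.
apply/eqP; rewrite -addr_eq0; apply/eqP.
have fD l := nabla_fiber hnabla tD (Hf l).
rewrite (ip_sym (gb_ip gE p) (fD j) (frame_fiber i)).
rewrite -(conn_metric hnabla tD (Hf i) (Hf j)) -(tangent_cst (i == j)%:R tD).
apply: (tangent_congr hM tD); apply: filterS (open_near oW Wp) => q Wq.
exact: (onf_orthonormal hf).
Qed.

Lemma connection_form_smooth i j :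
  smooth_at A p (fun q => inner q (nabla q (Y q) (f i)) (f j q)).
Proof.
apply: (gb_inner gE); last exact: frame_section.
apply: (section_at_nabla gE hnabla) => //; exact: frame_section.
Qed.

End Frames.

(** * Symmetries of the Riemann tensor *)

Section LeviCivita.
Variables (R : realType) (n : nat) (M : topologicalType) (A : atlas R n M).
Hypothesis hM : smooth_manifold A.
Variable g : M -> tvec R M -> tvec R M -> R.
Hypothesis hg : riemannian_metric A g.
Variable nabla : connection_op R M (tvec R M).
Hypothesis hLC : levi_civita A g nabla.
Implicit Types (p : M) (X Y Z U : M -> tvec R M).

Local Notation TM := (tangent_bundle A g).
Let gTM : germ_bundle A TM := tangent_germ_bundle hg.
Let hnabla : @metric_connection R n M A TM nabla := lc_metric hLC.

Lemma torsion_free p X Y : field_at A p X -> field_at A p Y ->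
  nabla p (X p) Y - nabla p (Y p) X = lie A X Y p.
Proof.
move=> HX HY; have [W [oW Wp WX WY]] := field_at2 HX HY.
exact: (lc_torsion hLC) Wp.
Qed.

(** Vanishing of the torsion holds on a whole neighbourhood of [p], so by locality it may be
    differentiated once more. *)
Lemma nabla_nablaB p X Y Z : field_at A p X -> field_at A p Y -> field_at A p Z ->
  nabla p (X p) (fun q => nabla q (Y q) Z) - nabla p (X p) (fun q => nabla q (Z q) Y)
  = nabla p (X p) (lie A Y Z).
Proof.
move=> HX HY HZ; have tX := field_at_tangent HX.
have HYZ : section_at (E := TM) p (fun q => nabla q (Y q) Z).
  exact: (section_at_nabla gTM hnabla).
have HZY : section_at (E := TM) p (fun q => nabla q (Z q) Y).
  exact: (section_at_nabla gTM hnabla).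
have HL : section_at (E := TM) p (lie A Y Z) by exact: (field_at_lie hM).
apply/eqP; rewrite subr_eq -(conn_addr hnabla tX HL HZY); apply/eqP.
have [W [oW Wp WY WZ]] := field_at2 HY HZ.
have E q : W q -> nabla q (Y q) Z = lie A Y Z q + nabla q (Z q) Y.
  by move=> Wq; rewrite -(lc_torsion hLC oW WY WZ Wq) subrK.
apply: (nabla_congr hM hnabla tX HYZ _ (filterS E (open_near oW Wp))).
exists W; split=> //.
apply: (vector_fieldD hM oW (vector_field_lie hM oW WY WZ)).
exact: (conn_smooth hnabla).
Qed.

(** Torsion freeness writes [X, [Y, Z]] as the derivative of [Y, Z] along X minus that of X along
    [Y, Z], and [nabla_nablaB] splits the former into second derivatives; the cyclic sum of
    curvatures thereby becomes Jacobi's identity. *)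
Lemma bianchi p X Y Z : field_at A p X -> field_at A p Y -> field_at A p Z ->
  curvature A nabla X Y Z p + curvature A nabla Y Z X p + curvature A nabla Z X Y p = 0.
Proof.
move=> HX HY HZ; rewrite -(lie_jacobi hM HX HY HZ).
have HL T T' : field_at A p T -> field_at A p T' -> field_at A p (lie A T T').
  exact: (field_at_lie hM).
rewrite -(torsion_free HX (HL _ _ HY HZ)) -(torsion_free HY (HL _ _ HZ HX)).
rewrite -(torsion_free HZ (HL _ _ HX HY)) -!nabla_nablaB// /curvature.
rewrite funeqE => h; rewrite !fctE; ring.
Qed.

Definition Rm p X Y Z U : R := g p (curvature A nabla X Y Z p) (U p).

Lemma Rm_anti12 p X Y Z U : field_at A p X -> field_at A p Y -> field_at A p Z ->
  field_at A p U -> Rm p X Y Z U = - Rm p Y X Z U.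
Proof.
move=> HX HY HZ HU.
rewrite /Rm [in LHS](curvatureC hM hnabla HX HY HZ) -scaleN1r -[RHS]mulN1r.
apply: (ip_scale (gb_ip gTM p)); last exact: (gb_fiber gTM).
exact: (curvature_fiber hM gTM hnabla).
Qed.

Lemma Rm_anti34 p X Y Z U : field_at A p X -> field_at A p Y -> field_at A p Z ->
  field_at A p U -> Rm p X Y Z U = - Rm p X Y U Z.
Proof. by move=> HX HY HZ HU; exact: (curvature_anti hM gTM hnabla). Qed.

Lemma Rm_bianchi p X Y Z U : field_at A p X -> field_at A p Y -> field_at A p Z ->
  field_at A p U -> Rm p X Y Z U + Rm p Y Z X U + Rm p Z X Y U = 0.
Proof.
move=> HX HY HZ HU; have fU := field_at_tangent HU.
have fR T T' T'' : field_at A p T -> field_at A p T' -> field_at A p T'' ->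
    tangent A p (curvature A nabla T T' T'' p).
  exact: (curvature_fiber hM gTM hnabla).
have tD := fiberD (gb_linear gTM (p := p)).
have gD v w : tangent A p v -> tangent A p w ->
    g p v (U p) + g p w (U p) = g p (v + w) (U p).
  by move=> tv tw; exact/esym/(ip_add (gb_ip gTM p) tv tw fU).
have [[t1 t2] t3] := (fR _ _ _ HX HY HZ, fR _ _ _ HY HZ HX, fR _ _ _ HZ HX HY).
rewrite /Rm !gD//; last exact: tD.
rewrite bianchi//; exact: (inner0l (gb_ip gTM p)).
Qed.

(** The four Bianchi identities, one for each choice of the last argument, and the antisymmetry in
    each pair form a linear system that implies the equality. *)
Lemma Rm_pair p X Y Z U : field_at A p X -> field_at A p Y -> field_at A p Z ->
  field_at A p U -> Rm p X Y Z U = Rm p Z U X Y.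
Proof.
move=> HX HY HZ HU.
have := Rm_bianchi HX HY HZ HU; have := Rm_bianchi HY HZ HU HX.
have := Rm_bianchi HZ HU HX HY; have := Rm_bianchi HU HX HY HZ.
have := (Rm_anti34 HX HY HZ HU, Rm_anti34 HX HZ HY HU, Rm_anti34 HY HZ HX HU,
  Rm_anti34 HZ HU HX HY, Rm_anti34 HY HU HX HZ, Rm_anti34 HX HU HY HZ).
have := (Rm_anti12 HX HZ HY HU, Rm_anti12 HY HU HX HZ, Rm_anti12 HY HU HZ HX,
  Rm_anti12 HX HU HY HZ, Rm_anti12 HX HU HZ HY).
case=> [[[[? ?] ?] ?] ?] [[[[[? ?] ?] ?] ?] ?]; lra.
Qed.

(** The contraction needs Bianchi's identity with [X] fixed in the first place. Pair symmetry and
    antisymmetry bring [X] to the last place, where [Rm_bianchi] leaves it fixed. *)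
Lemma Rm_cyclic234 p X Y Z U : field_at A p X -> field_at A p Y -> field_at A p Z ->
  field_at A p U -> Rm p X Y Z U + Rm p X Z U Y + Rm p X U Y Z = 0.
Proof.
move=> HX HY HZ HU.
rewrite (Rm_pair HX HY HZ HU) (Rm_pair HX HZ HU HY) (Rm_pair HX HU HY HZ).
rewrite (Rm_anti34 HZ HU HX HY) (Rm_anti34 HU HY HX HZ) (Rm_anti34 HY HZ HX HU).
have := Rm_bianchi HY HZ HU HX; lra.
Qed.

End LeviCivita.

(** * Clifford matrices *)

Section CliffordAlgebra.
Variable K : numFieldType.

Lemma sum_lt_half (V : lmodType K) n (G : 'I_n -> 'I_n -> V) :
  (forall i j, G j i = G i j) -> (forall i, G i i = 0) ->
  \sum_(i < n) \sum_(j < n | (i < j)%N) G i j = 2^-1 *: \sum_(i < n) \sum_(j < n) G i j.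
Proof.
move=> Gsym G0; set S := LHS.
suff E : \sum_(i < n) \sum_(j < n) G i j = S + S.
  by rewrite E -[S + S]mulr2n -[S *+ 2]scaler_nat scalerA mulVf ?scale1r ?pnatr_eq0.
have {2}-> : S = \sum_(i < n) \sum_(j < n | (j < i)%N) G i j.
  rewrite /S (exchange_big_dep xpredT)//=; apply: eq_bigr => j _.
  by apply: eq_bigr => i _; exact: Gsym.
rewrite -big_split; apply: eq_bigr => i _ /=.
rewrite (bigD1 i)//= G0 add0r (bigID (fun j : 'I_n => (i < j)%N))/=.
congr (_ + _); apply: eq_bigl => j; rewrite -val_eqE; by case: ltngtP.
Qed.

Variables (n d : nat) (gamma : 'I_n -> 'M[K]_d).
Hypothesis hgamma : forall i j,
  gamma i *m gamma j + gamma j *m gamma i = (- 2 * (i == j)%:R)%:M.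
Implicit Types a b c : 'I_n -> 'I_n -> K.

Definition quad c : 'M[K]_d := \sum_(i < n) \sum_(j < n) c i j *: (gamma i *m gamma j).

Lemma gamma_swap i j :
  gamma j *m gamma i = - (2 * (i == j)%:R)%:M - gamma i *m gamma j.
Proof.
have h := hgamma i j; rewrite mulNr raddfN /= in h.
by rewrite -h addrC addKr.
Qed.

(** The matrices anticommute off the diagonal, so antisymmetric coefficients make the summand
    symmetric in i and j, with zero diagonal. Sums over i < j can then be replaced by full sums,
    whose indices can be permuted freely. *)
Lemma quad_lt c : (forall i j, c j i = - c i j) ->
  \sum_(i < n) \sum_(j < n | (i < j)%N) c i j *: (gamma i *m gamma j) = 2^-1 *: quad c.
Proof.
move=> anti; have c0 i : c i i = 0.
  have /eqP := anti i i; rewrite -subr_eq0 opprK -mulr2n -mulr_natr mulf_eq0.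
  by rewrite pnatr_eq0 orbF => /eqP.
apply: sum_lt_half => [i j|i]; last by rewrite c0 scale0r.
rewrite anti gamma_swap; case: eqVneq => [->|_]; first by rewrite c0 oppr0 !scale0r.
by rewrite mulr0 raddf0 oppr0 add0r scalerN scaleNr opprK.
Qed.

Lemma sum_delta (V : lmodType K) (k : 'I_n) (F : 'I_n -> V) :
  \sum_i (k == i)%:R *: F i = F k.
Proof.
rewrite (bigD1 k)//= eqxx scale1r big1 ?addr0// => i ik.
by rewrite eq_sym (negPf ik) scale0r.
Qed.

(** The commutator of [4^-1 *: quad c] with [gamma k] is row [k] of [c] applied to the generators:
    this is the infinitesimal rotation [c], and it fixes the factor 1/4. *)
Lemma quad_gamma c k : (forall i j, c j i = - c i j) ->
  quad c *m gamma k = gamma k *m quad c + 4 *: \sum_j c k j *: gamma j.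
Proof.
move=> anti.
(* [gamma k] moves to the left past [gamma j], then past [gamma i]; each exchange leaves one
   Kronecker term. By antisymmetry of [c] the two terms add up, whence 4 = 2 + 2. *)
have step i j : gamma i *m gamma j *m gamma k = gamma k *m (gamma i *m gamma j)
    + 2 *: ((k == i)%:R *: gamma j) - 2 *: ((k == j)%:R *: gamma i).
  rewrite -mulmxA (gamma_swap k j) mulmxBr mulmxN mul_mx_scalar.
  rewrite !mulmxA (gamma_swap k i) mulmxBl mulNmx mul_scalar_mx.
  by rewrite opprB opprK addrC -!scalerA.
transitivity (\sum_(i < n) \sum_(j < n) (c i j *: (gamma k *m (gamma i *m gamma j))
    + 2 *: ((k == i)%:R *: (c i j *: gamma j)) - 2 *: ((k == j)%:R *: (c i j *: gamma i)))).
  rewrite mulmx_suml; apply: eq_bigr => i _; rewrite mulmx_suml; apply: eq_bigr => j _.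
  rewrite -scalemxAl step scalerBr scalerDr !scalerA.
  by congr (_ + _ *: _ - _ *: _); ring.
under eq_bigr do rewrite sumrB big_split/=.
rewrite sumrB big_split/= -addrA; congr (_ + _).
  rewrite /quad mulmx_sumr; apply: eq_bigr => i _; rewrite mulmx_sumr.
  by apply: eq_bigr => j _; rewrite scalemxAr.
rewrite exchange_big/= -sumrB scaler_sumr; apply: eq_bigr => j _.
rewrite -!scaler_sumr (sum_delta k (fun i => c i j *: gamma j)).
rewrite (sum_delta k (fun i => c j i *: gamma j)) (anti k j) scaleNr scalerN opprK.
by rewrite -scalerDl -natrD.
Qed.

(** The commutator with [quad a] is a derivation, so [quad_gamma] applies to each factor of
    [gamma k *m gamma l]. The coefficients on the right are those of a b^T - b a^T, the shape of the
    quadratic term in [structure_equation]. *)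
Lemma quad_bracket a b : (forall i j, a j i = - a i j) -> (forall i j, b j i = - b i j) ->
  quad a *m quad b - quad b *m quad a =
  4 *: quad (fun i j => \sum_k (a i k * b j k - b i k * a j k)).
Proof.
move=> antia antib.
have step k l : quad a *m (gamma k *m gamma l) = gamma k *m gamma l *m quad a +
    4 *: (\sum_i a k i *: (gamma i *m gamma l) + \sum_j a l j *: (gamma k *m gamma j)).
  rewrite mulmxA quad_gamma// mulmxDl -mulmxA quad_gamma// mulmxDr mulmxA -addrA.
  congr (_ + _); rewrite -scalemxAl -scalemxAr -scalerDr addrC mulmx_suml mulmx_sumr.
  congr (_ *: (_ + _)); apply: eq_bigr => i _; by rewrite -?scalemxAl -?scalemxAr.
have -> : quad a *m quad b = quad b *m quad a + 4 *: \sum_(k < n) \sum_(l < n) b k l *: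
    (\sum_i a k i *: (gamma i *m gamma l) + \sum_j a l j *: (gamma k *m gamma j)).
  rewrite {2 3}/quad mulmx_sumr mulmx_suml scaler_sumr -big_split; apply: eq_bigr => k _.
  rewrite mulmx_sumr mulmx_suml scaler_sumr -big_split; apply: eq_bigr => l _ /=.
  by rewrite -scalemxAr step scalerDr -!scalemxAl !scalerA (mulrC 4).
rewrite addrC addKr; congr (_ *: _).
transitivity (\sum_(i < n) \sum_(j < n) ((\sum_k a i k * b j k) *: (gamma i *m gamma j)) -
  \sum_(i < n) \sum_(j < n) ((\sum_k b i k * a j k) *: (gamma i *m gamma j))); last first.
  rewrite -sumrB; apply: eq_bigr => i _; rewrite -sumrB; apply: eq_bigr => j _.
  by rewrite -scalerBl sumrB.
under eq_bigr do under eq_bigr do rewrite scalerDr.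
under eq_bigr do rewrite big_split/=.
rewrite big_split/=; congr (_ + _).
  under [RHS]eq_bigr do under eq_bigr do rewrite scaler_suml.
  under [RHS]eq_bigr do rewrite exchange_big/=.
  rewrite [RHS]exchange_big/=; apply: eq_bigr => k _.
  rewrite [RHS]exchange_big/=; apply: eq_bigr => l _.
  rewrite scaler_sumr; apply: eq_bigr => i _.
  by rewrite scalerA antia (antib l k) mulrNN mulrC.
rewrite -sumrN; apply: eq_bigr => k _; rewrite -sumrN.
under eq_bigr do rewrite scaler_sumr.
rewrite exchange_big/=; apply: eq_bigr => j _.
rewrite scaler_suml -sumrN; apply: eq_bigr => l _.
by rewrite scalerA (antia j l) mulrN scaleNr.
Qed.

(** The factor 1/4 reproduces itself: 1/4 * 1/4 * 4 = 1/4. *)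
Lemma quad_quarter_bracket a b : (forall i j, a j i = - a i j) ->
  (forall i j, b j i = - b i j) ->
  (4^-1 *: quad a) *m (4^-1 *: quad b) - (4^-1 *: quad b) *m (4^-1 *: quad a) =
  4^-1 *: quad (fun i j => \sum_k (a i k * b j k - b i k * a j k)).
Proof.
move=> antia antib; rewrite -!scalemxAl -!scalemxAr -!scalerBr quad_bracket//.
by rewrite !scalerA divfK ?pnatr_eq0.
Qed.

Lemma gamma_cycle i j k :
  gamma j *m gamma k *m gamma i = gamma i *m gamma j *m gamma k
    + 2 *: ((i == j)%:R *: gamma k) - 2 *: ((i == k)%:R *: gamma j).
Proof.
rewrite -mulmxA (gamma_swap i k) mulmxBr mulmxN mul_mx_scalar.
rewrite !mulmxA (gamma_swap i j) mulmxBl mulNmx mul_scalar_mx.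
by rewrite opprB opprK addrC -!scalerA.
Qed.

Lemma bianchi_contraction (a : 'I_n -> 'I_n -> 'I_n -> K) :
  (forall i j k, a i k j = - a i j k) ->
  (forall i j k, a i j k + a j k i + a k i j = 0) ->
  \sum_i gamma i *m quad (a i) = - 2 *: \sum_i \sum_k a i i k *: gamma k.
Proof.
move=> anti cyc; set rhs := \sum_i \sum_k _.
pose mono i j k := gamma i *m gamma j *m gamma k.
have -> : \sum_i gamma i *m quad (a i) = \sum_i \sum_j \sum_k a i j k *: mono i j k.
  apply: eq_bigr => i _; rewrite mulmx_sumr; apply: eq_bigr => j _; rewrite mulmx_sumr.
  by apply: eq_bigr => k _; rewrite -scalemxAr mulmxA.
set T := LHS.
have a0 i j : a i j j = 0.
  have /eqP := anti i j j; rewrite -subr_eq0 opprK -mulr2n -mulr_natr mulf_eq0.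
  by rewrite pnatr_eq0 orbF => /eqP.
have sum3D F G H : \sum_i \sum_j \sum_k (F i j k + G i j k - H i j k) =
    \sum_i \sum_j \sum_k F i j k + \sum_i \sum_j \sum_k G i j k
    - \sum_i \sum_j \sum_k H i j k :> 'M[K]_d.
  rewrite -big_split -sumrB; apply: eq_bigr => i _.
  rewrite -big_split -sumrB; apply: eq_bigr => j _.
  by rewrite -big_split -sumrB.
have dij : \sum_i \sum_j \sum_k 2 *: ((i == j)%:R *: (a i j k *: gamma k)) = 2 *: rhs.
  rewrite scaler_sumr; apply: eq_bigr => i _; rewrite exchange_big scaler_sumr.
  by apply: eq_bigr => k _; rewrite -scaler_sumr (sum_delta i (fun j => a i j k *: gamma k)).
have dik : \sum_i \sum_j \sum_k 2 *: ((i == k)%:R *: (a i j k *: gamma j)) = - (2 *: rhs).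
  rewrite -scalerN -sumrN scaler_sumr; apply: eq_bigr => i _; rewrite -sumrN scaler_sumr.
  apply: eq_bigr => j _; rewrite -scaler_sumr (sum_delta i (fun k => a i j k *: gamma j)).
  by rewrite (anti i i j) scaleNr.
have djk : \sum_i \sum_j \sum_k 2 *: ((k == j)%:R *: (a i j k *: gamma i)) = 0.
  rewrite big1// => i _; rewrite big1// => j _.
  under eq_bigr do rewrite eq_sym.
  by rewrite -scaler_sumr (sum_delta j (fun k => a i j k *: gamma i)) a0 scale0r scaler0.
(* The Kronecker terms for i = j and i = k each contribute 2 copies of [rhs], the second after a
   change of sign by antisymmetry. *)
have T1 : \sum_i \sum_j \sum_k a i j k *: mono j k i = T + 4 *: rhs.
  transitivity (T + 2 *: rhs - - (2 *: rhs)); last first.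
    by rewrite opprK -addrA -scalerDl -natrD.
  rewrite -{1}dij -dik -sum3D; apply: eq_bigr => i _; apply: eq_bigr => j _.
  apply: eq_bigr => k _; rewrite /mono gamma_cycle scalerBr scalerDr !scalerA.
  by congr (_ + _ *: _ - _ *: _); ring.
(* Here the term for k = j meets the zero diagonal [a0], so only the term for i = k contributes. *)
have T2 : \sum_i \sum_j \sum_k a i j k *: mono k i j = T + 2 *: rhs.
  transitivity (T + 0 - - (2 *: rhs)); last by rewrite addr0 opprK.
  rewrite -[X in T + X]djk -dik -sum3D; apply: eq_bigr => i _; apply: eq_bigr => j _.
  apply: eq_bigr => k _.
  have -> : mono k i j = mono i j k + 2 *: ((k == j)%:R *: gamma i)
      - 2 *: ((i == k)%:R *: gamma j).
    by rewrite /mono (gamma_cycle k i j) (eq_sym i k) subrK addrK.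
  rewrite scalerBr scalerDr !scalerA.
  by congr (_ + _ *: _ - _ *: _); ring.
(* Renaming the indices moves the rotation from the monomial to the coefficient, where the cyclic
   identity can be applied. *)
have C1 : \sum_i \sum_j \sum_k a i j k *: mono j k i =
    \sum_i \sum_j \sum_k a k i j *: mono i j k.
  rewrite exchange_big; apply: eq_bigr => i _; rewrite exchange_big.
  by [].
have C2 : \sum_i \sum_j \sum_k a i j k *: mono k i j =
    \sum_i \sum_j \sum_k a j k i *: mono i j k.
  under eq_bigr do rewrite exchange_big.
  by rewrite exchange_big.
have : T + (T + 4 *: rhs) + (T + 2 *: rhs) = 0.
  rewrite -T1 -T2 C1 C2 -!big_split big1// => i _.
  rewrite -!big_split big1// => j _; rewrite -!big_split big1// => k _ /=.
  by rewrite -!scalerDl addrAC cyc scale0r.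
have -> : T + (T + 4 *: rhs) + (T + 2 *: rhs) = 3 *: (T + 2 *: rhs).
  have -> : 4 *: rhs = 2 *: rhs + 2 *: rhs by rewrite -scalerDl -natrD.
  clear; move: T (2 *: rhs) => t u; rewrite scaler_nat mulrSr mulr2n.
  by rewrite [X in _ = X + _]addrACA -[t + t + _]addrA.
move=> /eqP; rewrite scaler_eq0 pnatr_eq0/= addr_eq0 => /eqP ->.
by rewrite scaleNr.
Qed.

(** A bilinear form contracted with products of generators can be evaluated in another frame: its
    coefficients transform by [T] on one side, the generators on the other. *)
Lemma quad_frame (E : 'I_n -> 'M[K]_d) (T B : 'I_n -> 'I_n -> K) :
  (forall i, E i = \sum_l T i l *: gamma l) ->
  quad (fun i j => \sum_(k < n) \sum_(l < n) T k i * T l j * B k l) =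
  \sum_(k < n) \sum_(l < n) B k l *: (E k *m E l).
Proof.
move=> hE; rewrite /quad.
under eq_bigr do under eq_bigr do (rewrite scaler_suml; under eq_bigr do rewrite scaler_suml).
under eq_bigr do rewrite exchange_big/=.
rewrite exchange_big/=; apply: eq_bigr => k _.
under eq_bigr do rewrite exchange_big/=.
rewrite exchange_big/=; apply: eq_bigr => l _.
rewrite !hE mulmx_suml scaler_sumr; apply: eq_bigr => i _.
rewrite mulmx_sumr scaler_sumr; apply: eq_bigr => j _.
by rewrite -scalemxAl -scalemxAr !scalerA; congr (_ *: _); ring.
Qed.

(** This makes every identity proved for [gamma] available for Clifford multiplication by another
    orthonormal frame. *)
Lemma frame_clifford (E : 'I_n -> 'M[K]_d) (T : 'I_n -> 'I_n -> K) :
  (forall i, E i = \sum_l T i l *: gamma l) ->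
  (forall i j, \sum_l T i l * T j l = (i == j)%:R) ->
  forall i j, E i *m E j + E j *m E i = (- 2 * (i == j)%:R)%:M.
Proof.
move=> hE TON i j; rewrite -TON.
have prod u v : E u *m E v = \sum_k \sum_l (T u k * T v l) *: (gamma k *m gamma l).
  rewrite !hE mulmx_suml; apply: eq_bigr => k _; rewrite mulmx_sumr.
  by apply: eq_bigr => l _; rewrite -scalemxAl -scalemxAr scalerA.
rewrite !prod [X in _ + X]exchange_big -big_split/=.
transitivity (\sum_k \sum_l (k == l)%:R *: (- 2 * (T i k * T j l))%:M : 'M[K]_d).
  apply: eq_bigr => k _; rewrite -big_split; apply: eq_bigr => l _ /=.
  rewrite (mulrC (T j l)) -scalerDr hgamma -!mul_scalar_mx -!scalar_mxM.
  by congr (_%:M); ring.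
rewrite mulr_sumr raddf_sum; apply: eq_bigr => k _ /=.
by rewrite (sum_delta k (fun l => (- 2 * (T i k * T j l))%:M)).
Qed.

End CliffordAlgebra.

(** * Spinors *)

Section SpinorActions.
Variables (R : realType) (n r m : nat).
Local Notation C := R[i].
Local Notation D := (Delta R n r m).
Local Notation Mn := 'M[C]_(2 ^ n./2).
Local Notation Mr := 'M[C]_(2 ^ r./2).
Implicit Types (psi : D) (b : 'I_m).

Lemma scaleCE (c z : C) : c *: z = c * z.
Proof. by []. Qed.

Lemma DeltaZE (c : C) psi x : (c *: psi) x = c * psi x.
Proof. by rewrite ffunE. Qed.

Lemma act_left_is_linear (T : Mn) : linear (@act_left R n r m T).
Proof.
move=> c u v; apply/ffunP => x; rewrite !ffunE.
rewrite scaleCE mulr_sumr -big_split; apply: eq_bigr => j _ /=.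
by rewrite !ffunE mulrDr scaleCE mulrCA.
Qed.

HB.instance Definition _ (T : Mn) :=
  GRing.isLinear.Build C D D *:%R (@act_left R n r m T) (act_left_is_linear T).

Lemma act_factor_is_linear b (T : Mr) : linear (@act_factor R n r m b T).
Proof.
move=> c u v; apply/ffunP => x; rewrite !ffunE.
rewrite scaleCE mulr_sumr -big_split; apply: eq_bigr => j _ /=.
by rewrite !ffunE mulrDr scaleCE mulrCA.
Qed.

HB.instance Definition _ b (T : Mr) :=
  GRing.isLinear.Build C D D *:%R (@act_factor R n r m b T) (act_factor_is_linear b T).

Lemma act_lie_is_linear (T : Mr) : linear (@act_lie R n r m T).
Proof.
move=> c u v; rewrite /act_lie scaler_sumr -big_split; apply: eq_bigr => b _.
exact: linearP.
Qed.

HB.instance Definition _ (T : Mr) :=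
  GRing.isLinear.Build C D D *:%R (@act_lie R n r m T) (act_lie_is_linear T).

Lemma act_leftDZ (c : C) (T U : Mn) psi :
  act_left (c *: T + U) psi = c *: act_left T psi + act_left U psi.
Proof.
apply/ffunP => x; rewrite !ffunE scaleCE mulr_sumr -big_split.
by apply: eq_bigr => j _ /=; rewrite !mxE mulrDl mulrA.
Qed.

Lemma act_factorDZ b (c : C) (T U : Mr) psi :
  act_factor b (c *: T + U) psi = c *: act_factor b T psi + act_factor b U psi.
Proof.
apply/ffunP => x; rewrite !ffunE scaleCE mulr_sumr -big_split.
by apply: eq_bigr => j _ /=; rewrite !mxE mulrDl mulrA.
Qed.

Lemma act_lieDZ (c : C) (T U : Mr) psi :
  act_lie (c *: T + U) psi = c *: act_lie T psi + act_lie U psi.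
Proof.
rewrite /act_lie scaler_sumr -big_split; apply: eq_bigr => b _.
exact: act_factorDZ.
Qed.

Lemma act_leftM (T U : Mn) psi : act_left (T *m U) psi = act_left T (act_left U psi).
Proof.
apply/ffunP => x; rewrite !ffunE.
under eq_bigr do rewrite mxE mulr_suml.
rewrite exchange_big; apply: eq_bigr => j _ /=; rewrite ffunE mulr_sumr.
by apply: eq_bigr => k _; rewrite mulrA.
Qed.

Lemma act_factorM b (T U : Mr) psi :
  act_factor b (T *m U) psi = act_factor b T (act_factor b U psi).
Proof.
apply/ffunP => x; rewrite !ffunE.
under eq_bigr do rewrite mxE mulr_suml.
rewrite exchange_big; apply: eq_bigr => j _ /=; rewrite ffunE mulr_sumr.
apply: eq_bigr => k _; rewrite mulrA /= ffunE eqxx; congr (_ * psi (_, _)).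
by apply/ffunP => c; rewrite !ffunE; case: eqP.
Qed.

Lemma act_factor_comm b b' (T U : Mr) psi : b != b' ->
  act_factor b T (act_factor b' U psi) = act_factor b' U (act_factor b T psi).
Proof.
move=> bb'; apply/ffunP => x; rewrite !ffunE.
under eq_bigr do rewrite ffunE mulr_sumr.
under [RHS]eq_bigr do rewrite ffunE mulr_sumr.
rewrite exchange_big; apply: eq_bigr => j _ /=; apply: eq_bigr => k _.
rewrite !ffunE [b' == b]eq_sym (negPf bb') mulrCA; congr (_ * (_ * psi (_, _))).
apply/ffunP => c; rewrite !ffunE; case: eqP => // ->.
by rewrite eq_sym (negPf bb').
Qed.

Lemma act_left_lie_comm (T : Mn) (U : Mr) psi :
  act_left T (act_lie U psi) = act_lie U (act_left T psi).
Proof.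
rewrite /act_lie linear_sum; apply: eq_bigr => b _.
apply/ffunP => x; rewrite !ffunE.
under eq_bigr do rewrite ffunE mulr_sumr.
under [RHS]eq_bigr do rewrite ffunE mulr_sumr.
rewrite exchange_big; apply: eq_bigr => j _ /=; apply: eq_bigr => k _.
by rewrite mulrCA.
Qed.

(** Actions on different tensor factors commute, so only the diagonal terms of the double sum
    survive. *)
Lemma act_lie_bracket (T U : Mr) psi :
  act_lie T (act_lie U psi) - act_lie U (act_lie T psi) =
  act_lie (T *m U - U *m T) psi.
Proof.
rewrite [T *m U - _]addrC -[- (U *m T)]scaleN1r act_lieDZ scaleN1r.
rewrite /act_lie.
under eq_bigr do rewrite linear_sum.
under [X in _ - X = _]eq_bigr do rewrite linear_sum.
rewrite [X in _ - X]exchange_big -sumrB -sumrN -big_split; apply: eq_bigr => b _ /=.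
rewrite -sumrB (bigD1 b)//= big1 ?addr0; last first.
  by move=> b' b'b; rewrite act_factor_comm ?subrr// eq_sym.
by rewrite !act_factorM addrC.
Qed.

End SpinorActions.

(** * Differentiation of spinor-valued functions *)

Section SpinorDerivative.
Variables (R : realType) (n : nat) (M : topologicalType) (A : atlas R n M).
Hypothesis hM : smooth_manifold A.
Variables (r m : nat).
Local Notation C := R[i].
Local Notation D := (Delta R n r m).
Implicit Types (p q : M) (v : tvec R M) (psi chi : M -> D) (L : {linear D -> D}).

Definition spinor_smooth p psi := forall x,
  smooth_at A p (fun q => complex.Re (psi q x)) /\
  smooth_at A p (fun q => complex.Im (psi q x)).

Lemma ReD (z w : C) : complex.Re (z + w) = complex.Re z + complex.Re w.
Proof. by case: z w => [a b] [c d]. Qed.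

Lemma ImD (z w : C) : complex.Im (z + w) = complex.Im z + complex.Im w.
Proof. by case: z w => [a b] [c d]. Qed.

Lemma ReM (z w : C) :
  complex.Re (z * w) = complex.Re z * complex.Re w - complex.Im z * complex.Im w.
Proof. by case: z w => [a b] [c d]. Qed.

Lemma ImM (z w : C) :
  complex.Im (z * w) = complex.Re z * complex.Im w + complex.Im z * complex.Re w.
Proof. by case: z w => [a b] [c d]. Qed.

Lemma Re_sum (I : Type) (s : seq I) (z : I -> C) :
  complex.Re (\sum_(i <- s) z i) = \sum_(i <- s) complex.Re (z i).
Proof. by elim: s => [|i s IH]; rewrite ?big_nil// !big_cons ReD IH. Qed.

Lemma Im_sum (I : Type) (s : seq I) (z : I -> C) :
  complex.Im (\sum_(i <- s) z i) = \sum_(i <- s) complex.Im (z i).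
Proof. by elim: s => [|i s IH]; rewrite ?big_nil// !big_cons ImD IH. Qed.

Lemma spinor_smoothD p psi chi : spinor_smooth p psi -> spinor_smooth p chi ->
  spinor_smooth p (fun q => psi q + chi q).
Proof.
move=> Hpsi Hchi x; have [[aR aI] [bR bI]] := (Hpsi x, Hchi x).
split.
  apply: (smooth_at_congr hM _ (smooth_atD hM aR bR)).
  by apply: nearW => q; rewrite ffunE ReD.
apply: (smooth_at_congr hM _ (smooth_atD hM aI bI)).
by apply: nearW => q; rewrite ffunE ImD.
Qed.

Lemma derive_spinorD p v psi chi : tangent A p v ->
  spinor_smooth p psi -> spinor_smooth p chi ->
  derive_spinor v (fun q => psi q + chi q) = derive_spinor v psi + derive_spinor v chi.
Proof.
move=> tv Hpsi Hchi; apply/ffunP => x; have [[aR aI] [bR bI]] := (Hpsi x, Hchi x).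
rewrite !ffunE; apply/eqP; rewrite eq_complex/= -(tan_add tv aR bR) -(tan_add tv aI bI).
by apply/andP; split; apply/eqP; congr (v _); apply/funext => q; rewrite ffunE (ReD, ImD).
Qed.

Lemma spinor_smooth0 p : spinor_smooth p (fun=> 0).
Proof.
by move=> x; split; apply: (smooth_at_congr hM _ (smooth_at_cst A p 0));
  apply: nearW => q; rewrite ffunE.
Qed.

Lemma derive_spinor0 p v : tangent A p v -> derive_spinor v (fun=> 0 : D) = 0.
Proof.
move=> tv; apply/ffunP => x; rewrite !ffunE; apply/eqP; rewrite eq_complex/=.
by apply/andP; split; apply/eqP; rewrite -[RHS](tangent_cst 0 tv); congr (v _);
  apply/funext => q; rewrite ffunE.
Qed.

Lemma spinor_smooth_sum p (I : Type) (s : seq I) (psi : I -> M -> D) :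
  (forall i, spinor_smooth p (psi i)) ->
  spinor_smooth p (fun q => \sum_(i <- s) psi i q).
Proof.
move=> Hpsi; elim: s => [|i s IH].
  by under eq_fun do rewrite big_nil; exact: spinor_smooth0.
by under eq_fun do rewrite big_cons; exact: spinor_smoothD.
Qed.

Lemma derive_spinor_sum p v (I : Type) (s : seq I) (psi : I -> M -> D) :
  tangent A p v -> (forall i, spinor_smooth p (psi i)) ->
  derive_spinor v (fun q => \sum_(i <- s) psi i q) = \sum_(i <- s) derive_spinor v (psi i).
Proof.
move=> tv Hpsi; elim: s => [|i s IH].
  rewrite big_nil -[RHS](derive_spinor0 tv); congr (derive_spinor v _).
  by apply/funext => q; rewrite big_nil.
rewrite big_cons -IH -(derive_spinorD tv (Hpsi i) (spinor_smooth_sum s Hpsi)).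
by congr (derive_spinor v _); apply/funext => q; rewrite big_cons.
Qed.

(** The matrix of [L] in the basis of indicator functions; it reduces the derivative of [L] applied
    to a spinor to finitely many scalar functions. *)
Lemma linear_kernel L : exists K : Delta_basis n r m -> Delta_basis n r m -> C,
  forall phi y, L phi y = \sum_x K y x * phi x.
Proof.
pose unit x : D := [ffun z => (z == x)%:R].
exists (fun y x => L (unit x) y) => phi y.
have {1}-> : phi = \sum_x phi x *: unit x.
  apply/ffunP => z; rewrite sum_ffunE (bigD1 z)//= big1 ?addr0.
    by rewrite !ffunE eqxx scaleCE mulr1.
  by move=> x xz; rewrite !ffunE eq_sym (negPf xz) scaler0.
rewrite linear_sum sum_ffunE; apply: eq_bigr => x _.
by rewrite linearZ /= ffunE scaleCE mulrC.
Qed.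

(** Leibniz' rule for a real function times a constant endomorphism. Tangent vectors act on real
    functions only, hence the separate expansions [re] and [im]. *)
Lemma derive_spinor_op p v (c : M -> R) L psi : tangent A p v ->
  smooth_at A p c -> spinor_smooth p psi ->
  spinor_smooth p (fun q => (c q)%:C%C *: L (psi q)) /\
  derive_spinor v (fun q => (c q)%:C%C *: L (psi q)) =
  (v c : R)%:C%C *: L (psi p) + (c p)%:C%C *: L (derive_spinor v psi).
Proof.
move=> tv Hc Hpsi; have [K LK] := linear_kernel L.
have sK (a : R) f : smooth_at A p f -> smooth_at A p (fun q => a * f q).
  by move=> Hf; apply: smooth_atM => //; exact: smooth_at_cst.
have vK (a : R) f : smooth_at A p f -> v (fun q => a * f q) = a * v f.
  by move=> Hf; exact: (tan_scale tv).
pose re x y q := complex.Re (K y x) * complex.Re (psi q x) -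
  complex.Im (K y x) * complex.Im (psi q x).
pose im x y q := complex.Re (K y x) * complex.Im (psi q x) +
  complex.Im (K y x) * complex.Re (psi q x).
have Hre x y : smooth_at A p (re x y).
  by have [? ?] := Hpsi x; apply: smooth_atB => //; exact: sK.
have Him x y : smooth_at A p (im x y).
  by have [? ?] := Hpsi x; apply: smooth_atD => //; exact: sK.
have reE y : (fun q => complex.Re (((c q)%:C%C *: L (psi q)) y)) =
    fun q => c q * \sum_x re x y q.
  apply/funext => q; rewrite DeltaZE LK ReM /= mul0r subr0 Re_sum.
  by congr (_ * _); apply: eq_bigr => x _; rewrite ReM.
have imE y : (fun q => complex.Im (((c q)%:C%C *: L (psi q)) y)) =
    fun q => c q * \sum_x im x y q.
  apply/funext => q; rewrite DeltaZE LK ImM /= mul0r addr0 Im_sum.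
  by congr (_ * _); apply: eq_bigr => x _; rewrite ImM.
have Sre y := smooth_at_sum hM (index_enum _) (Hre ^~ y).
have Sim y := smooth_at_sum hM (index_enum _) (Him ^~ y).
split=> [y|]; first by rewrite reE imE; split; exact: smooth_atM.
have vre x y : v (re x y) = complex.Re (K y x * derive_spinor v psi x).
  have [HR HI] := Hpsi x.
  by rewrite (tangentB_fun hM tv) ?vK//; [rewrite ffunE ReM|exact: sK..].
have vim x y : v (im x y) = complex.Im (K y x * derive_spinor v psi x).
  have [HR HI] := Hpsi x.
  by rewrite (tan_add tv) ?vK//; [rewrite ffunE ImM|exact: sK..].
apply/ffunP => y; rewrite [LHS]ffunE reE imE !(tan_mul tv)// !(tangent_sum hM _ tv)//.
rewrite [RHS]ffunE !DeltaZE !LK; apply/eqP; rewrite eq_complex.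
rewrite ReD ImD !ReM !ImM /= !mul0r !subr0 !addr0 !Re_sum !Im_sum; apply/andP.
split; apply/eqP; rewrite addrC mulrC; congr (_ * _ + _ * _); apply: eq_bigr => x _.
- by rewrite ReM.
- exact: vre.
- by rewrite ImM.
- exact: vim.
Qed.

Variables (I : finType) (Lam : I -> {linear D -> D}) (c : I -> M -> tvec R M -> R).

(** The flat derivative plus real forms times constant endomorphisms. Real coefficients can be
    differentiated by a tangent vector, and all the Clifford algebra stays in the constants
    [Lam]. *)
Definition spinor_connection : connection_op R M D := fun q v psi =>
  derive_spinor v psi + \sum_i (c i q v)%:C%C *: Lam i (psi q).

(** Second derivatives of [psi] cancel against its derivative along the bracket, and the terms with
    one derivative of [psi] are symmetric in [X] and [Y]; the exterior derivative and the commutator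
    of the form remain. *)
Lemma curvature_spinor_connection p (X Y : M -> tvec R M) psi :
  field_at A p X -> field_at A p Y -> spinor_smooth p psi ->
  (forall i, smooth_at A p (fun q => c i q (X q))) ->
  (forall i, smooth_at A p (fun q => c i q (Y q))) ->
  let form v phi := \sum_i (c i p v)%:C%C *: Lam i phi in
  curvature A spinor_connection X Y psi p =
  \sum_i (X p (fun q => c i q (Y q)) - Y p (fun q => c i q (X q))
            - c i p (lie A X Y p))%:C%C *: Lam i (psi p)
  + (form (X p) (form (Y p) (psi p)) - form (Y p) (form (X p) (psi p))).
Proof.
move=> HX HY Hpsi cX cY form.
have Dsmooth Z : field_at A p Z -> spinor_smooth p (fun q => derive_spinor (Z q) psi).
  move=> HZ x; have [HR HI] := Hpsi x; split.
    by under eq_fun do rewrite ffunE; exact: field_at_smooth.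
  by under eq_fun do rewrite ffunE; exact: field_at_smooth.
have second Z Z' : field_at A p Z -> field_at A p Z' ->
    (forall i, smooth_at A p (fun q => c i q (Z' q))) ->
    spinor_connection p (Z p) (fun q => spinor_connection q (Z' q) psi) =
    derive_spinor (Z p) (fun q => derive_spinor (Z' q) psi)
    + \sum_i (Z p (fun q => c i q (Z' q)))%:C%C *: Lam i (psi p)
    + form (Z' p) (derive_spinor (Z p) psi) + form (Z p) (derive_spinor (Z' p) psi)
    + form (Z p) (form (Z' p) (psi p)).
  move=> HZ HZ' cZ'; have tZ := field_at_tangent HZ.
  have op i := derive_spinor_op (Lam i) tZ (cZ' i) Hpsi.
  rewrite {1}/spinor_connection (derive_spinorD tZ (Dsmooth _ HZ')); last first.
    by apply: spinor_smooth_sum => i; have [] := op i.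
  rewrite (derive_spinor_sum _ tZ); last by move=> i; have [] := op i.
  rewrite -!addrA; congr (_ + _).
  under eq_bigr do rewrite (op _).2.
  rewrite big_split/= -!addrA; do 2 congr (_ + _).
  rewrite /form -big_split; apply: eq_bigr => i _.
  by rewrite /spinor_connection linearD scalerDr.
rewrite /curvature !second// /spinor_connection.
have -> : derive_spinor (lie A X Y p) psi =
    derive_spinor (X p) (fun q => derive_spinor (Y q) psi) -
    derive_spinor (Y p) (fun q => derive_spinor (X q) psi).
  apply/ffunP => x; have [HR HI] := Hpsi x; rewrite !ffunE (lieE _ _ HR) (lieE _ _ HI).
  have dRe Z : (fun q => complex.Re (derive_spinor (Z q) psi x)) =
      fun q => Z q (fun q' => complex.Re (psi q' x)).
    by apply/funext => q; rewrite ffunE.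
  have dIm Z : (fun q => complex.Im (derive_spinor (Z q) psi x)) =
      fun q => Z q (fun q' => complex.Im (psi q' x)).
    by apply/funext => q; rewrite ffunE.
  by rewrite !dRe !dIm.
set l := \sum_i (c i p (lie A X Y p))%:C%C *: _.
have -> : \sum_i (X p (fun q => c i q (Y q)) - Y p (fun q => c i q (X q))
    - c i p (lie A X Y p))%:C%C *: Lam i (psi p) =
    \sum_i (X p (fun q => c i q (Y q)))%:C%C *: Lam i (psi p) -
    \sum_i (Y p (fun q => c i q (X q)))%:C%C *: Lam i (psi p) - l.
  by rewrite -!sumrB; apply: eq_bigr => i _; rewrite !rmorphB/= !scalerBl.
have reorder (a a' s s' u w t t' b : D) :
    a + s + u + w + t - (a' + s' + w + u + t') - (a - a' + b) = s - s' - b + (t - t').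
  by apply/ffunP => x; rewrite !ffunE; ring.
exact: reorder.
Qed.

End SpinorDerivative.

(** * The Lie algebra action on spinors *)

Section SpinAction.
Variables (R : realType) (n r m : nat).
Local Notation C := R[i].
Local Notation D := (Delta R n r m).
Variables (gamma : 'I_n -> 'M[C]_(2 ^ n./2)) (delta : 'I_r -> 'M[C]_(2 ^ r./2)).
Implicit Types (psi phi : D) (w : 'I_n -> 'I_n -> R) (h : 'I_r -> 'I_r -> R).

(** The same action with its arguments exchanged, so that linearity in the matrix can be declared as
    a structure. *)
Definition act_left_op psi (T : 'M[C]_(2 ^ n./2)) : D := act_left T psi.
Definition act_lie_op psi (T : 'M[C]_(2 ^ r./2)) : D := act_lie T psi.

HB.instance Definition _ psi := GRing.isLinear.Build C 'M[C]_(2 ^ n./2) D *:%R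
  (act_left_op psi) (fun c T U => act_leftDZ c T U psi).
HB.instance Definition _ psi := GRing.isLinear.Build C 'M[C]_(2 ^ r./2) D *:%R
  (act_lie_op psi) (fun c T U => act_lieDZ c T U psi).

Lemma act_left_sum2 (I J : finType) (P : I -> pred J) (c : I -> J -> C)
    (T : I -> J -> 'M[C]_(2 ^ n./2)) psi :
  act_left (\sum_i \sum_(j | P i j) c i j *: T i j) psi =
  \sum_i \sum_(j | P i j) c i j *: act_left (T i j) psi.
Proof.
rewrite -[LHS]/(act_left_op psi _) linear_sum; apply: eq_bigr => i _.
by rewrite linear_sum; apply: eq_bigr => j _; rewrite linearZ.
Qed.

Lemma act_lie_sum2 (I J : finType) (P : I -> pred J) (c : I -> J -> C)
    (T : I -> J -> 'M[C]_(2 ^ r./2)) psi :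
  act_lie (\sum_i \sum_(j | P i j) c i j *: T i j) psi =
  \sum_i \sum_(j | P i j) c i j *: act_lie (T i j) psi.
Proof.
rewrite -[LHS]/(act_lie_op psi _) linear_sum; apply: eq_bigr => i _.
by rewrite linear_sum; apply: eq_bigr => j _; rewrite linearZ.
Qed.

Lemma act_bracket (P P' : 'M[C]_(2 ^ n./2)) (Q Q' : 'M[C]_(2 ^ r./2)) phi :
  let act T U psi := act_left T psi + act_lie U psi in
  act P Q (act P' Q' phi) - act P' Q' (act P Q phi) =
  act (P *m P' - P' *m P) (Q *m Q' - Q' *m Q) phi.
Proof.
rewrite /= -act_lie_bracket.
have -> : act_left (P *m P' - P' *m P) phi =
    act_left P (act_left P' phi) - act_left P' (act_left P phi).
  by rewrite -!act_leftM; exact: (linearB (act_left_op phi)).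
rewrite (linearD (act_left P)) (linearD (act_left P')).
rewrite (linearD (act_lie Q)) (linearD (act_lie Q')) /= !act_left_lie_comm.
have reorder (a b c d b' c' a' d' : D) :
    a + b + (c + d) - (a' + c + (b + d')) = a - a' + (d - d').
  move=> *; apply/ffunP => x; rewrite !ffunE; ring.
exact: reorder.
Qed.

Definition toC (I : Type) (w : I -> I -> R) : I -> I -> C := fun i j => ((w i j)%:C)%C.

Lemma toC_anti (I : Type) (w : I -> I -> R) : (forall i j, w j i = - w i j) ->
  forall i j, toC w j i = - toC w i j.
Proof. by move=> anti i j; rewrite /toC anti rmorphN. Qed.

(* One factor 1/2 comes from lambda_n* (e_i e_j) = 2 E_ij, the other from
   summing over ordered pairs. *)
Definition spin_form w h phi : D :=
  act_left (4^-1 *: quad gamma (toC w)) phi + act_lie (4^-1 *: quad delta (toC h)) phi.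

Definition spin_index : finType := (('I_n * 'I_n) + ('I_r * 'I_r))%type.

Definition spin_op (x : spin_index) : {linear D -> D} :=
  match x with
  | inl ij => act_left (gamma ij.1 *m gamma ij.2)
  | inr kl => act_lie (delta kl.1 *m delta kl.2)
  end.

(** The index set contains all pairs, to be a plain finite type; pairs out of order get coefficient
    0, and 1/2 is the factor in [nabla_theta]. *)
Definition spin_coef w h (x : spin_index) : R :=
  match x with
  | inl ij => if (ij.1 < ij.2)%N then 2^-1 * w ij.1 ij.2 else 0
  | inr kl => if (kl.1 < kl.2)%N then 2^-1 * h kl.1 kl.2 else 0
  end.

Lemma spin_coef_sum w h phi :
  \sum_x (spin_coef w h x)%:C%C *: spin_op x phi =
  2^-1 *: (\sum_(i < n) \sum_(j < n | (i < j)%N)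
     (w i j)%:C%C *: act_left (gamma i *m gamma j) phi) +
  2^-1 *: (\sum_(k < r) \sum_(l < r | (k < l)%N)
     (h k l)%:C%C *: act_lie (delta k *m delta l) phi).
Proof.
have half (d : nat) (G : 'I_d -> 'I_d -> D) (u : 'I_d -> 'I_d -> R) :
    \sum_(x : 'I_d * 'I_d) (if (x.1 < x.2)%N then 2^-1 * u x.1 x.2 else 0)%:C%C *: G x.1 x.2
    = 2^-1 *: (\sum_(i < d) \sum_(j < d | (i < j)%N) (u i j)%:C%C *: G i j).
  rewrite -(pair_bigA _ (fun i j : 'I_d => (if (i < j)%N then 2^-1 * u i j else 0)%:C%C *: G i j))/=.
  rewrite scaler_sumr; apply: eq_bigr => i _; rewrite scaler_sumr [RHS]big_mkcond.
  apply: eq_bigr => j _; case: ifP => _; last by rewrite scale0r.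
  by rewrite rmorphM/= fmorphV/= rmorph_nat scalerA.
by rewrite big_sumType/= (half n (fun i j => act_left (gamma i *m gamma j) phi))
  (half r (fun k l => act_lie (delta k *m delta l) phi)).
Qed.

Hypotheses (hgamma : clifford_rep gamma) (hdelta : clifford_rep delta).

Lemma spin_coef_form w h phi :
  (forall i j, w j i = - w i j) -> (forall k l, h l k = - h k l) ->
  \sum_x (spin_coef w h x)%:C%C *: spin_op x phi = spin_form w h phi.
Proof.
move=> wA hA; rewrite spin_coef_sum /spin_form.
rewrite -act_left_sum2 -act_lie_sum2 (quad_lt hgamma (toC_anti wA)).
rewrite (quad_lt hdelta (toC_anti hA)).
rewrite -[act_left _ _]/(act_left_op phi _) -[act_lie _ _]/(act_lie_op phi _).
rewrite -!linearZ/= !scalerA -invfM -natrM.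
by [].
Qed.

Definition so_bracket (d : nat) (w w' : 'I_d -> 'I_d -> R) : 'I_d -> 'I_d -> R :=
  fun i j => \sum_k (w i k * w' j k - w' i k * w j k).

Lemma so_bracket_anti (d : nat) (w w' : 'I_d -> 'I_d -> R) i j :
  so_bracket w w' j i = - so_bracket w w' i j.
Proof. by rewrite -sumrN; apply: eq_bigr => k _; ring. Qed.

Lemma quad_so_bracket (d N : nat) (rho : 'I_d -> 'M[C]_N) (w w' : 'I_d -> 'I_d -> R) :
  (forall i j, rho i *m rho j + rho j *m rho i = (- 2 * (i == j)%:R)%:M) ->
  (forall i j, w j i = - w i j) -> (forall i j, w' j i = - w' i j) ->
  let P := 4^-1 *: quad rho (toC w) in let P' := 4^-1 *: quad rho (toC w') in
  P *m P' - P' *m P = 4^-1 *: quad rho (toC (so_bracket w w')).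
Proof.
move=> hrho wA w'A P P'.
rewrite /P /P' (quad_quarter_bracket hrho (toC_anti wA) (toC_anti w'A)).
congr (_ *: quad rho _).
apply/funext => i; apply/funext => j; rewrite /toC /so_bracket rmorph_sum.
by apply: eq_bigr => k _; rewrite rmorphB/= !rmorphM.
Qed.

Lemma spin_form_bracket w h w' h' phi :
  (forall i j, w j i = - w i j) -> (forall k l, h l k = - h k l) ->
  (forall i j, w' j i = - w' i j) -> (forall k l, h' l k = - h' k l) ->
  spin_form w h (spin_form w' h' phi) - spin_form w' h' (spin_form w h phi) =
  spin_form (so_bracket w w') (so_bracket h h') phi.
Proof.
move=> wA hA w'A h'A; rewrite /spin_form.
rewrite -(quad_so_bracket hgamma wA w'A) -(quad_so_bracket hdelta hA h'A).
exact: act_bracket.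
Qed.

Lemma eq_spin_form w h w' h' phi : (forall i j, w i j = w' i j) ->
  (forall k l, h k l = h' k l) -> spin_form w h phi = spin_form w' h' phi.
Proof.
move=> ww' hh'; have -> : w = w' by apply/funext => i; apply/funext.
by have -> : h = h' by apply/funext => i; apply/funext.
Qed.

Lemma spin_formD w h w' h' phi :
  spin_form w h phi + spin_form w' h' phi =
  spin_form (fun i j => w i j + w' i j) (fun k l => h k l + h' k l) phi.
Proof.
have quadD d N (rho : 'I_d -> 'M[C]_N) (u u' : 'I_d -> 'I_d -> R) :
    quad rho (toC (fun i j => u i j + u' i j)) = quad rho (toC u) + quad rho (toC u').
  rewrite /quad -big_split; apply: eq_bigr => i _; rewrite -big_split.
  by apply: eq_bigr => j _; rewrite /toC rmorphD/= scalerDl.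
rewrite /spin_form !quadD !scalerDr addrACA.
by congr (_ + _); [exact/esym/(linearD (act_left_op phi))
  | exact/esym/(linearD (act_lie_op phi))].
Qed.

End SpinAction.

(** * The spinor connection *)

Section Theta.
Variables (R : realType) (n r m : nat) (M : topologicalType) (A : atlas R n M).
Hypothesis hM : smooth_manifold A.
Variable g : M -> tvec R M -> tvec R M -> R.
Hypothesis hg : riemannian_metric A g.
Variable nablaM : connection_op R M (tvec R M).
Hypothesis hLC : levi_civita A g nablaM.
Variables (F : vbundle R M) (nablaF : connection_op R M (vb_carrier F)).
Hypotheses (gF : germ_bundle A F) (hnablaF : metric_connection A nablaF).
Variables (gamma : 'I_n -> 'M[R[i]]_(2 ^ n./2)) (delta : 'I_r -> 'M[R[i]]_(2 ^ r./2)).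
Hypotheses (hgamma : clifford_rep gamma) (hdelta : clifford_rep delta).
Variables (tau : lift_data n r F) (a : st_index tau).
Hypothesis oa : open (st_dom a).
Hypothesis he : orthonormal_frame (E := tangent_bundle A g) (st_dom a) (st_e a).
Hypothesis hf : orthonormal_frame (E := F) (st_dom a) (st_f a).

Local Notation C := R[i].
Local Notation TM := (tangent_bundle A g).
Let gTM : germ_bundle A TM := tangent_germ_bundle hg.
Let hnablaM : @metric_connection R n M A TM nablaM := lc_metric hLC.
Local Notation s := (st_e a).
Local Notation t := (st_f a).

Definition omega_e q v i j : R := g q (nablaM q v (s i)) (s j q).
Definition omega_f q v k l : R := vb_inner F q (nablaF q v (t k)) (t l q).

(** The component of index [a] of the derivative depends only on that component of [phi], so the
    curvature can be computed on functions with values in a fixed vector space. *)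
Lemma nabla_thetaE q v (phi : M -> spinor m tau) :
  nabla_theta g gamma delta nablaM nablaF q v phi a =
  spinor_connection (spin_op m gamma delta)
    (fun x q v => spin_coef (omega_e q v) (omega_f q v) x) q v (fun q => phi q a).
Proof.
by rewrite /spinor_connection spin_coef_sum addrA.
Qed.

Variables (X Y : M -> tvec R M) (p : M).
Hypotheses (HX : field_at A p X) (HY : field_at A p Y) (ap : st_dom a p).

Lemma curvature_theta (phi : M -> spinor m tau) :
  spinor_smooth A p (fun q => phi q a) ->
  curvature A (nabla_theta g gamma delta nablaM nablaF) X Y phi p a =
  spin_form gamma delta
    (fun i j => g p (curvature A nablaM X Y (s i) p) (s j p))
    (fun k l => vb_inner F p (curvature A nablaF X Y (t k) p) (t l p)) (phi p a).
Proof.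
move=> Hphi.
pose nt := nabla_theta g gamma delta (tau := tau) (m := m) nablaM nablaF.
pose c x q v := spin_coef (omega_e q v) (omega_f q v) x.
transitivity (curvature A (spinor_connection (spin_op m gamma delta) c) X Y
    (fun q => phi q a) p).
  have step Z Z' : nt p (Z p) (fun q => nt q (Z' q) phi) a =
      spinor_connection (spin_op m gamma delta) c p (Z p)
        (fun q => spinor_connection (spin_op m gamma delta) c q (Z' q) (fun q => phi q a)).
    rewrite [LHS]nabla_thetaE; congr (spinor_connection _ _ _ _ _).
    (* The identity holds at every [q], also outside [st_dom a], so it can be used under the outer
       derivative. *)
    by apply/funext => q; exact: nabla_thetaE.
  rewrite -[LHS]/(nt p (X p) (fun q => nt q (Y q) phi) a
    - nt p (Y p) (fun q => nt q (X q) phi) a - nt p (lie A X Y p) phi a).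
  by congr (_ - _ - _); [exact: step|exact: step|exact: nabla_thetaE].
have smooth_e Z i j : field_at A p Z -> smooth_at A p (fun q => omega_e q (Z q) i j).
  by move=> HZ; exact: (connection_form_smooth gTM oa ap he hnablaM HZ i j).
have smooth_f Z i j : field_at A p Z -> smooth_at A p (fun q => omega_f q (Z q) i j).
  by move=> HZ; exact: (connection_form_smooth gF oa ap hf hnablaF HZ i j).
have csmooth Z x : field_at A p Z -> smooth_at A p (fun q => c x q (Z q)).
  move=> HZ; rewrite /c; case: x => -[i j]; rewrite /spin_coef /=; case: (i < j)%N;
    by [exact: smooth_at_cst | apply: smooth_atM => //; [exact: smooth_at_cst|auto]].
rewrite (curvature_spinor_connection hM (spin_op m gamma delta) HX HY Hphi (fun x => csmooth X x HX) (fun x => csmooth Y x HY)).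
have [tX tY] := (field_at_tangent HX, field_at_tangent HY).
have tXY := lie_tangent hM HX HY.
have anti_e v : tangent A p v -> forall i j, omega_e p v j i = - omega_e p v i j.
  by move=> tv i j; exact: (connection_form_anti hM gTM oa ap he hnablaM).
have anti_f v : tangent A p v -> forall k l, omega_f p v l k = - omega_f p v k l.
  by move=> tv k l; exact: (connection_form_anti hM gF oa ap hf hnablaF).
(* The exterior derivative of the connection form [w], evaluated on [X] and [Y]. *)
pose d (I : Type) (w : M -> tvec R M -> I -> I -> R) i j : R :=
  X p (fun q => w q (Y q) i j) - Y p (fun q => w q (X q) i j) - w p (lie A X Y p) i j.
have -> : \sum_x (X p (fun q => c x q (Y q)) - Y p (fun q => c x q (X q))
    - c x p (lie A X Y p))%:C%C *: spin_op m gamma delta x (phi p a) =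
  \sum_x (spin_coef (d _ omega_e) (d _ omega_f) x)%:C%C *: spin_op m gamma delta x (phi p a).
  apply: eq_bigr => x _; congr ((_)%:C%C *: _); rewrite /c /d; case: x => -[i j]; rewrite /spin_coef /=.
    case: (i < j)%N; last by rewrite !(tangent_cst 0 tX, tangent_cst 0 tY) !subr0.
    by rewrite (tan_scale tX) ?(tan_scale tY)//; [ring|exact: smooth_e..].
  case: (i < j)%N; last by rewrite !(tangent_cst 0 tX, tangent_cst 0 tY) !subr0.
  by rewrite (tan_scale tX) ?(tan_scale tY)//; [ring|exact: smooth_f..].
have struct_e i j : g p (curvature A nablaM X Y (s i) p) (s j p) =
    d _ omega_e i j + so_bracket (omega_e p (X p)) (omega_e p (Y p)) i j.
  exact: (structure_equation hM gTM oa ap he hnablaM HX HY i j).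
have struct_f k l : vb_inner F p (curvature A nablaF X Y (t k) p) (t l p) =
    d _ omega_f k l + so_bracket (omega_f p (X p)) (omega_f p (Y p)) k l.
  exact: (structure_equation hM gF oa ap hf hnablaF HX HY k l).
have se := frame_section oa ap he; have sf := frame_section oa ap hf.
(* Antisymmetry of the exterior derivative follows from the structure equation, as the curvature and
   the bracket are antisymmetric. *)
have d_e i j : d _ omega_e j i = - d _ omega_e i j.
  have := curvature_anti hM gTM hnablaM HX HY (se i) (se j).
  move: (struct_e i j) (struct_e j i) => /= -> ->.
  by rewrite (so_bracket_anti _ _ i j); lra.
have d_f k l : d _ omega_f l k = - d _ omega_f k l.
  have := curvature_anti hM gF hnablaF HX HY (sf k) (sf l).
  rewrite struct_f (struct_f l k) (so_bracket_anti _ _ k l); lra.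
rewrite (spin_coef_form hgamma hdelta (phi p a) d_e d_f).
have formE v psi : tangent A p v ->
    \sum_x (c x p v)%:C%C *: spin_op m gamma delta x psi =
    spin_form gamma delta (omega_e p v) (omega_f p v) psi.
  by move=> tv; exact: (spin_coef_form hgamma hdelta psi (anti_e v tv) (anti_f v tv)).
rewrite (formE _ _ tX) (formE _ _ tY) (formE _ _ tX) (formE _ _ tY).
rewrite (spin_form_bracket hgamma hdelta (phi p a)
  (anti_e _ tX) (anti_f _ tX) (anti_e _ tY) (anti_f _ tY)).
by rewrite spin_formD; apply: eq_spin_form => i j; rewrite (struct_e, struct_f).
Qed.

End Theta.

(** * Change of orthonormal frame *)

Section FrameChange.
Variables (R : realType) (n : nat) (M : topologicalType) (A : atlas R n M).
Hypothesis hM : smooth_manifold A.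
Variables (E : vbundle R M) (nabla : connection_op R M (vb_carrier E)).
Hypotheses (gE : germ_bundle A E) (hnabla : metric_connection A nabla).
Variables (k : nat) (W V : set M) (f t : 'I_k -> M -> vb_carrier E) (p : M).
Hypotheses (oW : open W) (Wp : W p) (hf : orthonormal_frame W f).
Hypotheses (oV : open V) (Vp : V p) (ht : orthonormal_frame V t).
Variable rho : 'I_k -> 'M[R[i]]_(2 ^ k./2).
Hypothesis hrho : clifford_rep rho.
Local Notation inner := (vb_inner E p).

(** [t] stands for the frame of the lift, in which spinors have their components, and [f] for the
    frame of the statement. *)
Definition clifford_coord (v : vb_carrier E) : 'M[R[i]]_(2 ^ k./2) :=
  kappa_vec rho (fun l => inner v (t l p)).

Definition clifford_frame i := clifford_coord (f i p).

Lemma clifford_coord_expand v : vb_fiber E p v ->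
  clifford_coord v = \sum_i ((inner v (f i p))%:C)%C *: clifford_frame i.
Proof.
move=> Ev; have Et := frame_fiber gE oV Vp ht; have Ef := frame_fiber gE oW Wp hf.
rewrite /clifford_frame /clifford_coord /kappa_vec.
under [RHS]eq_bigr do rewrite scaler_sumr.
rewrite exchange_big; apply: eq_bigr => l _ /=.
rewrite (frame_parseval gE oW Wp hf Ev (Et l)) rmorph_sum scaler_suml.
apply: eq_bigr => i _; rewrite rmorphM scalerA; congr (_ * _ *: _).
by rewrite (ip_sym (gb_ip gE p) (Et l) (Ef i)).
Qed.

Lemma clifford_frame_rep : forall i j,
  clifford_frame i *m clifford_frame j + clifford_frame j *m clifford_frame i =
  (- 2 * (i == j)%:R)%:M.
Proof.
have Ef := frame_fiber gE oW Wp hf.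
apply: (frame_clifford hrho (T := toC (fun i l => inner (f i p) (t l p)))) => // i j.
transitivity ((inner (f i p) (f j p))%:C%C : R[i]).
  rewrite (frame_parseval gE oV Vp ht (Ef i) (Ef j)) rmorph_sum.
  by apply: eq_bigr => l _; rewrite rmorphM.
by rewrite (onf_orthonormal hf)// rmorph_nat.
Qed.

(** Tensoriality ([curvature_frame]) expresses the curvature coefficients in [t] through those in
    [f], and [quad_frame] absorbs the change of basis into the generators. *)
Lemma curvature_quad_frame X Y : field_at A p X -> field_at A p Y ->
  quad rho (toC (fun i j => inner (curvature A nabla X Y (t i) p) (t j p))) =
  quad clifford_frame (toC (fun i j => inner (curvature A nabla X Y (f i) p) (f j p))).
Proof.
move=> HX HY; have Et := frame_fiber gE oV Vp ht; have Ef := frame_fiber gE oW Wp hf.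
have st := frame_section oV Vp ht.
apply: etrans; last first.
  apply: (quad_frame (gamma := rho) (E := clifford_frame)
    (T := toC (fun i l => inner (f i p) (t l p)))) => i.
  by [].
apply: eq_bigr => i _; apply: eq_bigr => j _; congr (_ *: _).
rewrite [in LHS]/toC (curvature_frame hM gE oW Wp hf hnabla HX HY (st i) (st j)).
rewrite rmorph_sum; apply: eq_bigr => u _; rewrite rmorph_sum; apply: eq_bigr => v _.
rewrite !rmorphM (ip_sym (gb_ip gE p) (Et i) (Ef u)).
by rewrite (ip_sym (gb_ip gE p) (Et j) (Ef v)).
Qed.

End FrameChange.

(** The algebra at one point, with B i j k = <R^M (X, e_i) e_j, e_k> and Th i k l = Theta_kl (X,
    e_i). The sum of the B i i k over i is then the k-th component of Ric(X). *)
Lemma ricci_contraction (R : realType) (n r m : nat)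
    (gamma : 'I_n -> 'M[R[i]]_(2 ^ n./2)) (delta : 'I_r -> 'M[R[i]]_(2 ^ r./2))
    (B : 'I_n -> 'I_n -> 'I_n -> R) (Th : 'I_n -> 'I_r -> 'I_r -> R)
    (phi : Delta R n r m) :
  clifford_rep gamma -> clifford_rep delta ->
  (forall i j k, B i k j = - B i j k) ->
  (forall i j k, B i j k + B j k i + B k i j = 0) ->
  (forall i k l, Th i l k = - Th i k l) ->
  \sum_i act_left (gamma i) (spin_form gamma delta (B i) (Th i) phi) =
  - 2^-1 *: act_left (\sum_k ((\sum_i B i i k)%:C)%C *: gamma k) phi +
  2^-1 *: \sum_(k < r) \sum_(l < r | (k < l)%N)
    act_left (\sum_i ((Th i k l)%:C)%C *: gamma i) (act_lie (delta k *m delta l) phi).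
Proof.
move=> hgamma hdelta antiB cycB antiTh.
transitivity (\sum_i act_left (gamma i *m (4^-1 *: quad gamma (toC (B i)))) phi +
    \sum_i act_left (gamma i) (act_lie (4^-1 *: quad delta (toC (Th i))) phi)).
  rewrite -big_split; apply: eq_bigr => i _.
  by rewrite (linearD (act_left (gamma i))) act_leftM.
congr (_ + _).
  transitivity (act_left (4^-1 *: \sum_i gamma i *m quad gamma (toC (B i))) phi).
    rewrite scaler_sumr; rewrite -[RHS]/(act_left_op phi _) linear_sum.
    by apply: eq_bigr => i _; rewrite -scalemxAr.
  rewrite (bianchi_contraction hgamma (a := fun i => toC (B i))); last 2 first.
  - by move=> i j k; rewrite /toC antiB rmorphN.
  - by move=> i j k; rewrite /toC -!rmorphD cycB.
  have -> : \sum_i \sum_k toC (B i) i k *: gamma k =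
      \sum_k ((\sum_i B i i k)%:C)%C *: gamma k.
    rewrite exchange_big; apply: eq_bigr => k _ /=.
    by rewrite rmorph_sum scaler_suml.
  (* The coefficient is 1/4 * (-2) = -1/2. *)
  rewrite -[LHS]/(act_left_op phi _) scalerA linearZ; congr (_ *: _).
  by field.
transitivity (\sum_i act_left (gamma i) (2^-1 *: \sum_(k < r) \sum_(l < r | (k < l)%N)
    ((Th i k l)%:C)%C *: act_lie (delta k *m delta l) phi)).
  apply: eq_bigr => i _; congr (act_left _ _).
  have anti : forall k l, toC (Th i) l k = - toC (Th i) k l.
    by apply: toC_anti => k l; exact: antiTh.
  rewrite -act_lie_sum2 (quad_lt hdelta anti).
  rewrite -[LHS]/(act_lie_op phi _) -[act_lie _ phi]/(act_lie_op phi _) -linearZ scalerA.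
  by congr (act_lie_op phi (_ *: _)); field.
under eq_bigr do rewrite linearZ linear_sum.
rewrite -scaler_sumr exchange_big; congr (_ *: _); apply: eq_bigr => k _.
under eq_bigr do rewrite linear_sum.
rewrite exchange_big; apply: eq_bigr => l _ /=.
rewrite -[RHS]/(act_left_op _ _) linear_sum; apply: eq_bigr => i _.
by rewrite !linearZ.
Qed.

(** The formula is local and is checked in one local section of the lift, so the three cases can be
    treated together. *)
Lemma spinor_bundle_lift (R : realType) (n r m : nat) (M : topologicalType)
    (A : atlas R n M) g (F : vbundle R M) posM posF (sigma tau : lift_data n r F) :
  spinr_structure A g posM posF sigma ->
  spinor_bundle_from m A g posM posF sigma tau ->
  exists G, is_lift A g posM posF G tau.
Proof.
move=> hsigma [_|tau' htau'|tau' _ htau']; [by exists SpinR|by exists SpinSpin|by exists SpinSO].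
Qed.

Theorem proposition3p1 (R : realType) (n r m : nat) (hr : (2 <= r)%N)
  (M : topologicalType) (A : atlas R n M) (hM : smooth_manifold A)
  (g : M -> tvec R M -> tvec R M -> R) (hg : riemannian_metric A g)
  (posM : M -> ('I_n -> tvec R M) -> Prop)
  (hposM : orientation (E := tangent_bundle A g) posM)
  (nablaM : connection_op R M (tvec R M)) (hLC : levi_civita A g nablaM)
  (F : vbundle R M) (hF : riemannian_bundle A r F)
  (posF : M -> ('I_r -> vb_carrier F) -> Prop)
  (hposF : orientation posF)
  (nablaF : connection_op R M (vb_carrier F)) (hnablaF : metric_connection A nablaF)
  (gamma : 'I_n -> 'M[R[i]]_(2 ^ n./2)) (hgamma : clifford_rep gamma)
  (delta : 'I_r -> 'M[R[i]]_(2 ^ r./2)) (hdelta : clifford_rep delta)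
  (sigma : lift_data n r F) (hsigma : spinr_structure A g posM posF sigma)
  (tau : lift_data n r F)
  (hS : spinor_bundle_from m A g posM posF sigma tau)
  (W : set M) (hW : open W)
  (e : 'I_n -> M -> tvec R M)
  (he : orthonormal_frame (E := tangent_bundle A g) W e)
  (f : 'I_r -> M -> vb_carrier F) (hf : orthonormal_frame W f)
  (X : M -> tvec R M) (hX : vector_field A setT X)
  (phi : M -> spinor m tau) (hphi : spinor_section A gamma delta phi)
  (p : M) (hp : W p) (a : st_index tau) (ha : st_dom a p) :
  (\sum_(i < n) clifford_mul g gamma p (e i p)
     (curvature A (nabla_theta g gamma delta nablaM nablaF) X (e i) phi p)) a
  = (- 2^-1 *: clifford_mul g gamma p (ricci A nablaM e X p) (phi p)
     + 2^-1 *: (\sum_(k < r) \sum_(l < r | (k < l)%N)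
         clifford_mul g gamma p
           (sharp e (interior_form X (theta_form A nablaF f k l)) p)
           (kappa_star delta p (f k p) (f l p) (phi p)))) a.
Proof.
have [G htau] := spinor_bundle_lift hsigma hS.
have oa := st_open htau a.
have hs := st_frame_e htau a; have ht := st_frame_f htau a.
have gTM := tangent_germ_bundle hg; have gF := riemannian_germ_bundle hM hF.
have hnablaM := lc_metric hLC.
have HX : field_at A p X.
  by exists setT; split=> //; exact: openT.
have He i : field_at A p (e i) by exists W; split=> //; exact: (onf_section he).
have Hf := frame_section hW hp hf.
have fe i := field_at_tangent (He i).
have Hphi : spinor_smooth A p (fun q => phi q a).
  by move=> x; have [HR HI] := hphi.1 a x; split; exists (st_dom a).
pose Ec := clifford_frame (E := tangent_bundle A g) e (st_e a) p gamma.
pose Fc := clifford_frame f (st_f a) p delta.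
pose B i j k := g p (curvature A nablaM X (e i) (e j) p) (e k p).
pose Th i k l := vb_inner F p (curvature A nablaF X (e i) (f k) p) (f l p).
have hEc : clifford_rep Ec.
  exact: (clifford_frame_rep gTM hW hp he oa ha hs hgamma).
have hFc : clifford_rep Fc.
  exact: (clifford_frame_rep gF hW hp hf oa ha ht hdelta).
(* [curvature_theta] gives the coefficients in the frames of the lift; [quadE] and [quadF] pass to
   [e] and [f], with [Ec] and [Fc] as generators. *)
have curvE i : curvature A (nabla_theta g gamma delta nablaM nablaF) X (e i) phi p a =
    spin_form Ec Fc (B i) (Th i) (phi p a).
  have quadE : quad gamma (toC (fun j k =>
      g p (curvature A nablaM X (e i) (st_e a j) p) (st_e a k p))) = quad Ec (toC (B i)).
    exact: (curvature_quad_frame hM gTM hnablaM hW hp he oa ha hs gamma HX (He i)).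
  have quadF : quad delta (toC (fun k l =>
      vb_inner F p (curvature A nablaF X (e i) (st_f a k) p) (st_f a l p))) =
      quad Fc (toC (Th i)).
    exact: (curvature_quad_frame hM gF hnablaF hW hp hf oa ha ht delta HX (He i)).
  rewrite (curvature_theta hM hg hLC gF hnablaF hgamma hdelta oa hs ht HX (He i) ha Hphi).
  by rewrite /spin_form quadE quadF.
have fR i j : tangent A p (curvature A nablaM X (e i) (e j) p).
  exact: (curvature_fiber hM gTM hnablaM HX (He i) (He j)).
have tsum := fiber_sum (gb_zero gTM p) (gb_linear gTM (p := p)).
have expand v : tangent A p v -> kappa_vec gamma (coord_e g a p v) =
    \sum_i ((g p v (e i p))%:C)%C *: Ec i.
  exact: (clifford_coord_expand gTM hW hp he oa ha hs gamma).
have ricE : kappa_vec gamma (coord_e g a p (ricci A nablaM e X p)) =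
    \sum_k ((\sum_i B i i k)%:C)%C *: Ec k.
  rewrite expand; last by apply: tsum => i; exact: fR.
  apply: eq_bigr => k _; congr (_%:C%C *: _).
  exact: (inner_suml (gb_ip gTM p) (gb_zero gTM p) (gb_linear gTM (p := p)) _
    (fun i => fR i i) (fe k)).
have sharpE k l : kappa_vec gamma (coord_e g a p
      (sharp e (interior_form X (theta_form A nablaF f k l)) p)) =
    \sum_i ((Th i k l)%:C)%C *: Ec i.
  rewrite expand; last first.
    by apply: tsum => i; exact: (fiberZ (gb_zero gTM p) (gb_linear gTM (p := p)) _ (fe i)).
  apply: eq_bigr => i _; congr (_%:C%C *: _).
  transitivity (\sum_j Th j k l * g p (e j p) (e i p)).
    exact: (inner_sumZl (gb_ip gTM p) (gb_zero gTM p) (gb_linear gTM (p := p))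
      (fun j => Th j k l) fe (fe i)).
  rewrite (bigD1 i)//= big1 ?addr0 => [|j ji];
    rewrite -[g p]/(vb_inner (tangent_bundle A g) p) (onf_orthonormal he)//.
    by rewrite eqxx mulr1.
  by rewrite (negPf ji) mulr0.
have lhsE : (\sum_(i < n) clifford_mul g gamma p (e i p)
     (curvature A (nabla_theta g gamma delta nablaM nablaF) X (e i) phi p)) a =
  \sum_i act_left (Ec i) (spin_form Ec Fc (B i) (Th i) (phi p a)).
  rewrite fct_sumE; apply: eq_bigr => i _.
  by rewrite /clifford_mul curvE.
rewrite lhsE ricci_contraction//; last 3 first.
- by move=> i j k; exact: (Rm_anti34 hM hg hLC HX (He i) (He k) (He j)).
- by move=> i j k; exact: (Rm_cyclic234 hM hg hLC HX (He i) (He j) (He k)).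
- by move=> i k l; exact: (curvature_anti hM gF hnablaF HX (He i) (Hf l) (Hf k)).
rewrite -ricE -[RHS]/(_ + _); congr (_ + _ *: _).
rewrite fct_sumE; apply: eq_bigr => k _; rewrite fct_sumE; apply: eq_bigr => l _.
(* [kappa_star] of [f k p] and [f l p] is by definition the action of [Fc k *m Fc l], so only the
   vector factor has to be rewritten. *)
by rewrite -sharpE.
Qed.
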